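(* Let $n\geq 7$ and let $G$ be a subgroup of the symmetric group $S_n$. Let $C$ be a coset of $G$ in $S_n$ such that $$\frac{|\{\sigma\in C : \sigma \text{ has no fixed points}\}|}{|C|}=\frac{|\{\sigma\in A_n : \sigma \text{ has no fixed points}\}|}{|A_n|}.$$ Then $G=A_n$.
   Context: $S_n$ is the group of permutations of $\{1,\dots,n\}$ and $A_n\subset S_n$ is the alternating group. A permutation $\sigma$ has no fixed points if $\sigma(i)\ne i$ for all $i\in\{1,\dots,n\}$. *)

(* Defs.v *)
From mathcomp Require Import all_boot all_order all_algebra.
From mathcomp Require Import all_fingroup all_solvable.

Set Implicit Arguments.
Unset Strict Implicit.
Unset Printing Implicit Defensive.

Import GRing.Theory.
Local Open Scope ring_scope.

Definition derangement (n : nat) (s : 'S_n) : bool := [forall i, s i != i].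

Definition derangement_ratio (n : nat) (C : {set 'S_n}) : rat :=
  #|[set s in C | derangement s]|%:R / #|C|%:R.

(* Main.v *)
Require Import Defs.
From mathcomp Require Import all_boot all_order all_algebra.
From mathcomp Require Import all_fingroup all_solvable.
From mathcomp Require Import zify ring.

(* Let [K] be the index of [G] and [E = D_n + (-1)^(n-1) (n-1)] twice the number of even
   derangements. The hypothesis says [K * #(derangements of C) = E], so [K] divides [E]; and [E]
   is congruent to [2], [-4], [6] up to sign modulo [n], [n - 3], [n - 4].
   If [G] is intransitive, [K] is a multiple of some binomial [C(n, m)]; if [G] is imprimitive
   with [k] blocks of size [d], [K] is a multiple of [n! / (k! d!^k)]. Comparing valuations at
   the prime divisors of [n], [n - 3] and [n - 4] shows that neither number divides [E], so [G]
   is primitive.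
   For [n >= 8] some odd prime [p <= n - 3] dividing [n - 3] or [n - 4] does not divide [E],
   hence not [K]: [G] contains a Sylow [p]-subgroup of [S_n], thus a [p]-cycle, and Jordan's
   theorem gives [K <= 2]. For [n = 7] a subgroup without 3-cycles has order 168 and is the
   automorphism group of a Fano plane, none of whose cosets has [1860 / 30 = 62] derangements.
   Finally [K = 1] is impossible since even and odd derangements are not equally many. *)

(** * Even derangements *)

Section Derangements.

Import GRing.Theory.
Local Open Scope ring_scope.

(** Left multiplication by a transposition of two points of [A] permutes these permutations and
    reverses signs, so the sum is its own negative as soon as [A] has two points. *)
Lemma sum_sign_perm_on (T : finType) (A : {set T}) :
  \sum_(s : {perm T} | perm_on A s) (-1) ^+ s = (#|A| <= 1)%:R :> int.
Proof.
have [leA|] := leqP #|A| 1.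
  rewrite (big_pred1 1%g) ?odd_perm1 // => s.
  by apply/idP/eqP => [/perm_on_id -> //|->]; rewrite perm_on1.
case/card_gt1P => x [y [Ax Ay nxy]].
have on_t : perm_on A (tperm x y).
  by apply: subset_trans (tperm_on x y) _; rewrite subUset !sub1set Ax Ay.
set S := \sum_(_ | _) _.
suff : S = - S by move: S => S; lia.
rewrite {1}/S (reindex_inj (mulgI (tperm x y))) -sumrN.
apply: eq_big => [s|s _]; last first.
  by rewrite odd_mul_tperm nxy signr_addb mulN1r.
apply/idP/idP => [on_ts|]; last exact: perm_onM.
by rewrite -[s](tpermKg x y) /= perm_onM.
Qed.

(** Expand the product over [i] of [1 - [s i = i]]: [A] collects the indices where the term 1 is
    chosen, and its contribution vanishes unless [s] fixes every point outside [A]. *)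
Lemma derangement_inclusion_exclusion (n : nat) (s : 'S_n) :
  (derangement s)%:R
    = \sum_(A : {set 'I_n} | perm_on A s) (-1) ^+ #|~: A| :> int.
Proof.
have -> : (derangement s)%:R = \prod_i (1 + - (s i == i)%:R) :> int.
  have [/forallP ds|] := boolP (derangement s).
    by rewrite big1 // => i _; rewrite (negPf (ds i)) subr0.
  rewrite negb_forall => /existsP[i]; rewrite negbK => /eqP si.
  by rewrite (bigD1 i) //= si eqxx subrr mul0r.
rewrite bigA_distr (bigID (fun A => perm_on A s)) /= [X in _ + X]big1 ?addr0.
  apply: eq_bigr => A on_s; rewrite -prodr_const [RHS]big_mkcond /=.
  apply: eq_bigr => i _; rewrite inE; case: ifP => //= /negbT Ai.
  by rewrite (out_perm on_s) // eqxx.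
move=> A /subsetPn[i /=]; rewrite inE => si Ai.
by rewrite (bigD1 i) //= (negPf Ai) (negPf si) oppr0 mul0r.
Qed.

(** The weight is general so as to serve both the plain count and the count with signs. *)
Lemma sum_derangements (n : nat) (w : 'S_n -> int) :
  \sum_(s | derangement s) w s
    = \sum_(A : {set 'I_n}) (-1) ^+ #|~: A| * \sum_(s | perm_on A s) w s.
Proof.
rewrite big_mkcond /=.
under eq_bigr do rewrite -mulrb -mulr_natl derangement_inclusion_exclusion mulr_suml big_mkcond.
rewrite exchange_big /=; apply: eq_bigr => A _.
by rewrite mulr_sumr [RHS]big_mkcond /=; apply: eq_bigr => s _; case: ifP.
Qed.

Lemma sum_sets_by_card (n : nat) (f : nat -> int) :
  \sum_(A : {set 'I_n}) f #|A| = \sum_(j < n.+1) f j *+ 'C(n, j).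
Proof.
have cardA (A : {set 'I_n}) : (#|A| < n.+1)%N.
  by rewrite ltnS -[n in (_ <= n)%N]card_ord max_card.
rewrite (partition_big (fun A => Ordinal (cardA A)) predT) //=.
apply: eq_bigr => j _; rewrite -[n in 'C(n, _)]card_ord -card_draws -sumr_const.
apply: eq_big => [A|A]; first by rewrite !inE -val_eqE.
by rewrite -val_eqE /= => /eqP->.
Qed.

(** Only the empty set and the [n] singletons survive in the inclusion-exclusion sum. *)
Lemma sum_sign_derangements (n : nat) :
  (0 < n)%N -> \sum_(s : 'S_n | derangement s) (-1) ^+ s = (-1) ^+ n * (1 - n%:R) :> int.
Proof.
move=> n_gt0; rewrite sum_derangements.
under eq_bigr do rewrite sum_sign_perm_on cardsCs setCK card_ord.
rewrite (sum_sets_by_card n (fun j => (-1) ^+ (n - j) * (j <= 1)%:R)).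
case: n n_gt0 => // n _; rewrite !big_ord_recl big1 => [|i _]; last by rewrite mulr0 mul0rn.
rewrite /= bin0 bin1 subn0 subSS subn0 exprS -[n.+1%:R]natr1; ring.
Qed.

Lemma count_derangements (n : nat) :
  #|[set s : 'S_n | derangement s]|%:R
    = \sum_(j < n.+1) (-1) ^+ (n - j) * (n ^_ j)%:R :> int.
Proof.
rewrite -sum1_card natr_sum (eq_bigl (@derangement n)) => [|s]; last by rewrite inE.
rewrite sum_derangements.
under eq_bigr => A _.
  rewrite -natr_sum sum1_card card_perm cardsCs setCK card_ord; over.
rewrite (sum_sets_by_card n (fun j => (-1) ^+ (n - j) * j`!%:R)).
by apply: eq_bigr => j _; rewrite -mulrnAr -mulrnA mulnC bin_ffact.
Qed.

(** For [n > 1], doubling makes this [n!] times the derangement ratio of the alternating group. *)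
Definition twice_even_derangements (n : nat) : nat :=
  (2 * #|[set s in ('Alt_('I_n))%g | derangement s]|)%N.

Lemma twice_even_derangementsE (n : nat) : (0 < n)%N ->
  (twice_even_derangements n)%:R
    = \sum_(j < n.+1) (-1) ^+ (n - j) * (n ^_ j)%:R + (-1) ^+ n * (1 - n%:R) :> int.
Proof.
move=> n_gt0; rewrite -count_derangements -sum_sign_derangements //.
rewrite -[X in X%:R + _]sum1_card natr_sum big_mkcond [X in _ + X]big_mkcond -big_split /=.
rewrite /twice_even_derangements natrM -[X in _ * X%:R]sum1_card natr_sum mulr_sumr [LHS]big_mkcond.
apply: eq_bigr => s _; rewrite in_set Alt_even in_set.
by case: derangement; case: (odd_perm s).
Qed.


Lemma dvdn_ffact (n k j : nat) : (k < j)%N -> (n - k %| n ^_ j)%N.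
Proof. by move=> ltkj; rewrite ffact_prod (bigD1 (Ordinal ltkj)) //= dvdn_mulr. Qed.

(* Modulo [n - k] only the first [k + 1] terms of the sum survive. *)
Lemma twice_even_derangements_mod (n k : nat) : (0 < n)%N -> (k <= n)%N ->
  ((n - k)%:Z %| (twice_even_derangements n)%:Z * (-1) ^+ n
    - (\sum_(j < k.+1) (-1) ^+ j * (n ^_ j)%:R + 1 - n%:R))%Z.
Proof.
move=> n_gt0 lekn; rewrite -natz twice_even_derangementsE // mulrDl.
rewrite mulr_suml; set f := fun j => (-1) ^+ j * (n ^_ j)%:R : int.
have -> : \sum_(j < n.+1) (-1) ^+ (n - j) * (n ^_ j)%:R * (-1) ^+ n = \sum_(j < n.+1) f j.
  apply: eq_bigr => j _; rewrite mulrAC -exprD /f.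
  have -> : (n - j + n = j + (n - j) * 2)%N by have := ltn_ord j; lia.
  by rewrite exprD exprM sqrr_sign mulr1.
rewrite -!(big_mkord xpredT f) (big_cat_nat (n := k.+1)) //=.
set S := \sum_(0 <= i < _) _; rewrite [_ * _ * _]mulrAC -exprD addnn -muln2 exprM sqrr_sign mul1r.
rewrite (_ : _ - _ = \sum_(k.+1 <= i < n.+1) f i); last by ring.
rewrite big_seq; apply: rpred_sum => j.
rewrite mem_index_iota => /andP[ltkj _]; rewrite /f dvdz_mull //.
by rewrite natz dvdzE /= dvdn_ffact.
Qed.

(** Modulo [q] the truncated sum is congruent to [c], and also to [twice_even_derangements n] up to
    sign, which is 0. *)
Lemma dvd_twice_even_derangements (n k q : nat) (c : int) :
  (0 < n)%N -> (k <= n)%N -> (q %| n - k)%N -> (q %| twice_even_derangements n)%N ->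
  ((n - k)%:Z %| \sum_(j < k.+1) (-1) ^+ j * (n ^_ j)%:R + 1 - n%:R - c)%Z ->
  (q %| `|c|)%N.
Proof.
move=> n_gt0 lekn qnk qE nkc.
have nk := twice_even_derangements_mod n k n_gt0 lekn.
rewrite -[q]/(`|q%:Z|%N) -dvdzE.
have qnkZ : (q%:Z %| (n - k)%:Z)%Z by rewrite dvdzE.
have /dvdz_trans/(_ nk) := qnkZ.
have /dvdz_trans/(_ nkc) := qnkZ.
set S := \sum_(_ < _) _ => h1 h2.
have h3 : (q%:Z %| (twice_even_derangements n)%:Z * (-1) ^+ n)%Z.
  by rewrite dvdz_mulr // dvdzE.
have -> : c = (twice_even_derangements n)%:Z * (-1) ^+ n
    - ((twice_even_derangements n)%:Z * (-1) ^+ n - (S + 1 - n%:R))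
    - (S + 1 - n%:R - c) by ring.
by apply: rpredB => //; apply: rpredB.
Qed.

Lemma dvd_twice_even_derangements0 (n q : nat) :
  (0 < n)%N -> (q %| n)%N -> (q %| twice_even_derangements n)%N -> (q %| 2)%N.
Proof.
move=> n_gt0 qn qE; apply: (@dvd_twice_even_derangements n 0 q 2) => //; rewrite subn0 //.
rewrite big_ord1 ffactn0 expr0 mul1r (_ : _ - _ = n%:Z * -1) ?dvdz_mulr // !natz; lia.
Qed.

Lemma dvd_twice_even_derangements3 (n q : nat) :
  (3 <= n)%N -> (q %| n - 3)%N -> (q %| twice_even_derangements n)%N -> (q %| 4)%N.
Proof.
move=> n_ge3 qn qE; have n_gt0 : (0 < n)%N by apply: leq_trans n_ge3.
apply: (@dvd_twice_even_derangements n 3 q (-4)) => //.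
set N := (n - 3)%N; have {qn qE n_gt0 n_ge3} -> : n = (N + 3)%N by rewrite subnK.
(* As a polynomial in [N = n - 3], the truncated sum has constant term [-4]; the cofactor of [N] is
   the rest. *)
rewrite (_ : _ - _ = N%:Z * (- (N%:Z * N%:Z) - 5 * N%:Z - 8)) ?dvdz_mulr //.
rewrite !big_ord_recl big_ord0 /= /bump /= !exprS !expr0 !ffactnS !ffactn0 addn3 /= !natz; lia.
Qed.

Lemma dvd_twice_even_derangements4 (n q : nat) :
  (4 <= n)%N -> (q %| n - 4)%N -> (q %| twice_even_derangements n)%N -> (q %| 6)%N.
Proof.
move=> n_ge4 qn qE; have n_gt0 : (0 < n)%N by apply: leq_trans n_ge4.
apply: (@dvd_twice_even_derangements n 4 q 6) => //.
set N := (n - 4)%N; have {qn qE n_gt0 n_ge4} -> : n = (N + 4)%N by rewrite subnK.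
rewrite (_ : _ - _ = N%:Z * (N%:Z * N%:Z * N%:Z + 9 * (N%:Z * N%:Z) + 27 * N%:Z + 29)) ?dvdz_mulr
  //.
rewrite !big_ord_recl big_ord0 /= /bump /= !exprS !expr0 !ffactnS !ffactn0 addn4 /= !natz; lia.
Qed.

End Derangements.

(** * The ratio hypothesis as an identity for the index *)

Section Index.

Import GRing.Theory Num.Theory.
Local Open Scope group_scope.

Lemma card_coset (gT : finGroupType) (G : {group gT}) (C : {set gT}) :
  C \in lcosets G [set: gT] \/ C \in rcosets G [set: gT] -> #|C| = #|G|.
Proof.
by case=> [/lcosetsP[x _ ->]|/rcosetsP[x _ ->]]; rewrite ?card_lcoset ?card_rcoset.
Qed.

(** Clear denominators, using that [n!] is both twice the order of the alternating group and [#|G|]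
    times the index. *)
Lemma derangements_mul_index (n : nat) (G : {group 'S_n}) (C : {set 'S_n}) :
  1 < n -> #|C| = #|G| -> derangement_ratio C = derangement_ratio 'Alt_('I_n) ->
  (#|[set s in C | derangement s]| * #|[set: 'S_n] : G| = twice_even_derangements n)%N.
Proof.
move=> n_gt1 oC; rewrite /derangement_ratio oC => /eqP.
have nz (H : {group 'S_n}) : (#|H|%:R != 0 :> rat)%R by rewrite pnatr_eq0 -lt0n cardG_gt0.
rewrite (eqr_div _ _ (nz G) (nz _)) -!natrM eqr_nat => /eqP eqC.
apply/eqP; rewrite -(eqn_pmul2r (cardG_gt0 G)) -mulnA [(_ * #|G|)%N in X in X == _]mulnC Lagrange
  ?subsetT //.
have oA : (2 * #|'Alt_('I_n)%G| = n`!)%N by rewrite -[n in RHS]card_ord card_Alt ?card_ord.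
rewrite cardsT card_Sn -oA /twice_even_derangements -[X in _ == X]mulnA -eqC.
by rewrite mulnCA.
Qed.

End Index.

(** * Orders of intransitive and imprimitive groups *)

Section Actions.

Local Open Scope group_scope.

(** Modulo the pointwise stabiliser of [S], the group [G] embeds in the symmetric group of [S]. *)
Lemma acts_dvd_fact (aT : finGroupType) (rT : finType) (to : {action aT &-> rT})
    (G : {group aT}) (S : {set rT}) :
  [acts G, on S | to] -> #|G| %| #|S|`! * #|'C_G(S | to)|.
Proof.
move=> nSG.
have kerE : 'ker (actperm <[nSG]>) = 'C_G(S | to).
  by rewrite ker_actperm astab_actby setIT.
rewrite -(Lagrange (subsetIl G 'C(S | to))) mulnC dvdn_mul //.
have -> : #|G : 'C_G(S | to)| = #|actperm <[nSG]> @* G|.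
  by rewrite card_morphim kerE setIid.
rewrite -perm.card_Sym; apply: cardSg.
apply/subsetP => _ /morphimP[g Gg _ ->]; rewrite inE; apply/subsetP => x.
rewrite inE; apply: contraR => Sx.
by rewrite actpermE /= /actby (negPf Sx).

Qed.

Lemma acts_all_dvd_fact (T : finType) (G : {group {perm T}}) (r : seq {set T}) :
    (forall B, B \in r -> [acts G, on B | 'P]) ->
  #|G| %| (\prod_(B <- r) #|B|`!) * #|'C_G(\bigcup_(B <- r) B | 'P)|.
Proof.
elim: r G => [|B r IHr] G nrG.
  rewrite big_nil mul1n big_nil (setIidPl _) //.
  by apply/subsetP=> s _; apply/astabP=> x; rewrite inE.
have /acts_dvd_fact/dvdn_trans := nrG B (mem_head _ _); apply.
rewrite !big_cons -mulnA dvdn_mul //.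
have {IHr} := IHr 'C_G(B | 'P)%G; rewrite -setIA -astabU; apply=> C rC.
by apply: subset_trans (subsetIl _ _) _; apply: nrG; rewrite inE rC orbT.
Qed.

Lemma acts_cover_dvd_fact (T : finType) (G : {group {perm T}}) (r : seq {set T}) :
    (forall B, B \in r -> [acts G, on B | 'P]) -> \bigcup_(B <- r) B = setT ->
  #|G| %| \prod_(B <- r) #|B|`!.
Proof.
move=> /acts_all_dvd_fact + cov; rewrite cov.
by rewrite (trivgP (aperm_faithful G)) cards1 muln1.
Qed.

(** [G] preserves [O] and its complement, so its order divides the product of the two factorials. *)
Lemma invariant_set_dvd_index (T : finType) (G : {group {perm T}}) (O : {set T}) :
  [acts G, on O | 'P] -> 'C(#|T|, #|O|) %| #|[set: {perm T}] : G|.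
Proof.
move=> nOG; have leOT : #|O| <= #|T| by apply: max_card.
have /dvdnP[q oG] : #|G| %| #|O|`! * (#|T| - #|O|)`!.
  have := @acts_cover_dvd_fact T G [:: O; ~: O].
  rewrite !big_cons !big_nil muln1 setU0 setUCr [#|~: O|]cardsCs setCK => -> // B.
  by rewrite !inE => /orP[]/eqP-> //; rewrite astabsC.
have := Lagrange (subsetT G); rewrite (card_Sym T) -(bin_fact leOT) oG => oT.
by apply/dvdnP; exists q; apply/eqP; rewrite -(eqn_pmul2l (cardG_gt0 G)) oT; apply/eqP; ring.
Qed.

(** The image of [G] on the blocks accounts for [#|Q|!]; the kernel preserves every block, which
    accounts for one factor [d!] per block. *)
Lemma partition_dvd_index (T : finType) (G : {group {perm T}}) (Q : {set {set T}}) (d : nat) :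
    partition Q [set: T] -> [acts G, on Q | 'P^*] -> {in Q, forall B : {set T}, #|B| = d} ->
  #|G| %| #|Q|`! * d`! ^ #|Q|.
Proof.
move=> /and3P[/eqP covQ _ _] nQG dQ.
have /acts_dvd_fact/dvdn_trans := nQG; apply; rewrite dvdn_mul //.
have := @acts_cover_dvd_fact T 'C_G(Q | 'P^*)%G (enum Q).
rewrite !big_enum /= -/(cover Q) covQ (eq_bigr (fun=> d`!)) => [|B QB]; last by rewrite dQ.
rewrite prod_nat_const; apply=> // B; rewrite mem_enum => QB.
apply/subsetP=> s /setIP[_ /astabP/(_ B QB)/= sB].
by rewrite -astab1_set; apply/astab1P.
Qed.

End Actions.

(** * Valuations of factorials *)

Section Arithmetic.

Lemma dvdn_div_gcd (a m c : nat) : 0 < a -> a %| m * c -> a %/ gcdn a m %| c.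
Proof.
move=> a_gt0 a_mc; have g_gt0 : 0 < gcdn a m by rewrite gcdn_gt0 a_gt0.
have co : coprime (a %/ gcdn a m) (m %/ gcdn a m).
  by rewrite /coprime -(eqn_pmul2r g_gt0) muln_gcdl !divnK ?dvdn_gcdl ?dvdn_gcdr // mul1n.
rewrite -(Gauss_dvdr _ co) -(dvdn_pmul2r g_gt0) divnK ?dvdn_gcdl //.
by rewrite mulnAC divnK ?dvdn_gcdr.
Qed.

(** One step of Legendre's formula: the multiples of [p] up to [n] are [p] times
    [1, ..., n %/ p]. *)
Lemma logn_fact_div (p n : nat) : prime p -> logn p n`! = n %/ p + logn p (n %/ p)`!.
Proof.
move=> p_pr; have p_gt0 := prime_gt0 p_pr.
elim: n => [|n IHn]; first by rewrite div0n logn1.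
rewrite factS lognM ?fact_gt0 // IHn divnS //.
case: (boolP (p %| n.+1)) => [pn|pn]; last by rewrite lognE (negPf pn) !andbF.
have nE : n.+1 = p * (n %/ p).+1 by have := divnK pn; rewrite divnS // pn; lia.
by rewrite nE lognM // logn_prime // eqxx add1n factS lognM ?fact_gt0 //; lia.
Qed.

Lemma fact_exp_dvdn (q k : nat) : q`! ^ k %| (k * q)`!.
Proof.
elim: k => // k IHk; rewrite mulSn -(bin_fact (leq_addr (k * q) q)) addKn expnS.
by rewrite dvdn_mull // dvdn_mul.
Qed.

Lemma logn_fact_leq (p m n : nat) : m <= n -> logn p m`! <= logn p n`!.
Proof. by move=> lemn; rewrite -(bin_fact lemn) dvdn_leq_log ?muln_gt0 ?bin_gt0 ?fact_gt0 ?lemn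
  // dvdn_mull // dvdn_mulr. Qed.

(* In base [p], multiplying [d] by [k] produces no carry out of the last digit. *)
Lemma modn_mul_of_logn_fact (p k d : nat) :
    prime p -> k < p -> logn p (k * d)`! = k * logn p d`! ->
  (k * d) %% p = k * (d %% p).
Proof.
move=> p_pr ltkp eqv; have p_gt0 := prime_gt0 p_pr.
have kdE : k * d = k * (d %/ p) * p + k * (d %% p) by rewrite -mulnA -mulnDr -divn_eq.
have kd_div : (k * d) %/ p = k * (d %/ p) + (k * (d %% p)) %/ p by rewrite {1}kdE divnMDl.
have : k * logn p (d %/ p)`! <= logn p ((k * d) %/ p)`!.
  rewrite -lognX kd_div; apply: leq_trans (logn_fact_leq p _ _ (leq_addr _ _)).
  by apply: dvdn_leq_log; rewrite ?fact_gt0 ?fact_exp_dvdn.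
move: eqv; rewrite logn_fact_div // [in X in _ = X]logn_fact_div // kd_div mulnDr => eqv ineq.
have /eqP : (k * (d %% p)) %/ p = 0.
  move: eqv ineq; move: ((k * (d %% p)) %/ p) (d %/ p) => e q eqv ineq {kdE kd_div}.
  lia.
rewrite -leqn0 leqNgt divn_gt0 // -ltnNge => lt.
by rewrite kdE modnMDl modn_small.
Qed.


(* Legendre's formula makes [logn p d`!] equal to [(d - s) / (p - 1)], where [s] is the
   base-[p] digit sum of [d]. *)
Lemma logn_fact_ltn (p d : nat) : prime p -> 0 < d ->
  p.-1 * logn p d`! < d /\ (p.-1 * logn p d`! = d.-1 -> exists w, d = p ^ w).
Proof.
move=> p_pr; have p_gt1 := prime_gt1 p_pr; have p_gt0 := ltnW p_gt1.
elim/ltn_ind: d => d IHd d_gt0.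
have [ltdp|ledp] := ltnP d p.
  rewrite logn_fact_div // divn_small // logn1 muln0; split=> // /esym d1.
  by exists 0; rewrite expn0; lia.
have q_gt0 : 0 < d %/ p by rewrite divn_gt0.
have [lt eqp] := IHd _ (ltn_Pdiv p_gt1 d_gt0) q_gt0.
have dE := divn_eq d p.
rewrite logn_fact_div // mulnDr; set q := d %/ p in q_gt0 lt eqp dE *.
have pqE : p.-1 * q + q = q * p by rewrite -mulSnr prednK // mulnC.
split; first lia.
move=> eqd; have [|w qE] := eqp; first lia.
by exists w.+1; rewrite expnSr -qE {1}dE (_ : d %% p = 0) ?addn0 //; lia.
Qed.

Lemma bin_multiple (k d : nat) : 0 < d -> 'C(k * d, d) = k * 'C((k * d).-1, d.-1).
Proof.
move=> d_gt0; apply/eqP; rewrite -(eqn_pmul2l d_gt0); apply/eqP.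
by have := mul_bin_diag (k * d) d.-1; rewrite prednK // => <-; ring.
Qed.

(** Subtraction-free form of the fact that the valuation of [(k * d)! / (k! * d!^k)] is
    nondecreasing in [k]: consecutive values of this quotient differ by the factor
    ['C((k.+1 * d).-1, d.-1)]. *)
Lemma logn_fact_block (p d j k : nat) : prime p -> 0 < d -> j <= k ->
  logn p (j * d)`! + logn p k`! + k * logn p d`!
    <= logn p (k * d)`! + logn p j`! + j * logn p d`!.
Proof.
move=> p_pr d_gt0; elim: k => [|k IHk]; first by rewrite leqn0 => /eqP->.
rewrite leq_eqVlt => /orP[/eqP->|]; first by lia.
rewrite ltnS => /IHk {IHk} le_jk.
have le : d <= k.+1 * d by rewrite mulSn leq_addr.
have bin_pos : 0 < 'C((k.+1 * d).-1, d.-1) by rewrite bin_gt0; lia.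
have -> : logn p (k.+1 * d)`!
    = logn p k.+1 + logn p 'C((k.+1 * d).-1, d.-1) + (logn p d`! + logn p (k * d)`!).
  by rewrite -(bin_fact le) bin_multiple // mulSn addKn -mulSn !lognM ?muln_gt0 ?fact_gt0.
rewrite factS lognM ?fact_gt0 //; lia.
Qed.

(** By monotonicity the quotient for [p] blocks is prime to [p] as well. This reads
    [d - 1 <= (p - 1) * logn p d!], the extreme case of Legendre's bound, reached only by powers of
    [p]. *)
Lemma pfactor_of_logn_fact (p k d : nat) :
    prime p -> 0 < d -> p <= k -> logn p (k * d)`! = logn p k`! + k * logn p d`! ->
  exists w, d = p ^ w.
Proof.
move=> p_pr d_gt0 lepk eqv; have p_gt0 := prime_gt0 p_pr.
have := logn_fact_block p d p k p_pr d_gt0 lepk.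
rewrite eqv logn_fact_div // mulKn // (logn_fact_div p p) // divnn p_gt0 [1`!]/= logn1.
have [lt] := logn_fact_ltn p d p_pr d_gt0; move=> eqd le; apply: eqd.
have : p.-1 * logn p d`! + logn p d`! = p * logn p d`! by rewrite -mulSnr prednK.
lia.
Qed.

Lemma fact_blocks_dvdn (k d : nat) : 0 < d -> k`! * d`! ^ k %| (k * d)`!.
Proof.
move=> d_gt0; elim: k => // k IHk.
have le : d <= k.+1 * d by rewrite mulSn leq_addr.
rewrite -(bin_fact le) bin_multiple // mulSn addKn -mulSn factS expnS.
rewrite (_ : _ * _ = k.+1 * (d`! * (k`! * d`! ^ k))); last by ring.
by rewrite -mulnA dvdn_mul // dvdn_mull // dvdn_mul.
Qed.

End Arithmetic.

(** * Binomials and block counts that do not divide [E] *)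

Section BlockArithmetic.

(** With [m = r + 2] the divisor is [2 * m - 3]. It is coprime to [r + 1], hence divides
    ['C(2 * r + 1, r)], and the recurrences between neighbouring binomials carry it up. *)
Lemma dvdn_central_binomial (r : nat) : 2 * r + 1 %| r.+2 * 'C(2 * r.+2, r.+2).
Proof.
have c0 : (2 * r + 1) * 'C(2 * r, r) = r.+1 * 'C(2 * r + 1, r).
  by have := mul_bin_down (2 * r + 1) r; rewrite addn1 /= => ->; congr (_ * _); lia.
have c1 : (2 * r + 2) * 'C(2 * r + 1, r) = r.+1 * 'C(2 * r + 2, r.+1).
  by have := mul_bin_diag (2 * r + 2) r; rewrite addn1 addn2 /=.
have c2 : (2 * r + 3) * 'C(2 * r + 2, r.+1) = r.+2 * 'C(2 * r + 3, r.+1).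
  by have := mul_bin_down (2 * r + 3) r.+1; rewrite addn2 addn3 /= => ->; congr (_ * _); lia.
have c3 : (2 * r + 4) * 'C(2 * r + 3, r.+1) = r.+2 * 'C(2 * r + 4, r.+2).
  by have := mul_bin_diag (2 * r + 4) r.+1; rewrite addn3 addn4 /=.
have co : coprime (2 * r + 1) r.+1.
  have -> : 2 * r + 1 = r.+1 + r by lia.
  by rewrite coprime_sym /coprime gcdnDl -/(coprime _ _) coprimeSn.
have d0 : 2 * r + 1 %| 'C(2 * r + 1, r) by rewrite -(Gauss_dvdr _ co) -c0 dvdn_mulr.
have d1 : 2 * r + 1 %| 'C(2 * r + 2, r.+1) by rewrite -(Gauss_dvdr _ co) -c1 dvdn_mull.
have -> : 2 * r.+2 = 2 * r + 4 by lia.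
have -> : r.+2 * 'C(2 * r + 4, r.+2) = 2 * (r.+2 * 'C(2 * r + 3, r.+1)) by rewrite -c3; lia.
by rewrite -c2 !dvdn_mull.
Qed.

(** The odd number [a = 2 * m - 3] divided by its gcd with [m] divides the binomial, hence [E],
    hence 4, so it is 1; but then [a] divides the smaller number [m]. The factor 2 in [2 * E] serves
    the case of two blocks. *)
Lemma central_binomial_ndvd (m E : nat) : 7 <= 2 * m ->
    (forall q, q %| 2 * m - 3 -> q %| E -> q %| 4) ->
  ~~ ('C(2 * m, m) %| 2 * E).
Proof.
move=> m_ge4 E3; apply/negP => CE.
have [r mE] : exists r, m = r.+2 by exists m.-2; lia.
move: m_ge4 E3 CE; rewrite {}mE => m_ge4 E3 CE.
have [a a_eq] : exists a, a = 2 * r + 1 by exists (2 * r + 1).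
have aE : 2 * r.+2 - 3 = a by rewrite a_eq; clear; lia.
have a_gt : r.+2 < a by clear -a_eq m_ge4; lia.
have a_odd : odd a by clear -a_eq; lia.
have := dvdn_central_binomial r; rewrite -a_eq => aC.
have := dvdn_div_gcd _ _ _ (leq_ltn_trans (leq0n _) a_gt) aC; set q := _ %/ _ => qC.
have qa : q %| a by rewrite /q dvdn_div ?dvdn_gcdl.
have q_odd : odd q by apply: dvdn_odd qa a_odd.
have qE : q %| E by rewrite -(@Gauss_dvdr q 2) ?coprimen2 //; apply: dvdn_trans CE.
rewrite aE in E3; have q4 := E3 q qa qE.
have /eqP q1 : q == 1.
  have co4 : coprime q (2 ^ 2) by rewrite coprimeXr // coprimen2.
  by rewrite -dvdn1 -(Gauss_dvdl 1 co4) mul1n.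
have ar : a %| r.+2.
  by rewrite -(divnK (dvdn_gcdl a r.+2)) -/q q1 mul1n dvdn_gcdr.
by have := dvdn_leq (ltn0Sn _) ar; rewrite leqNgt a_gt.
Qed.

(** The quotient [n / gcd(n, m)] divides the binomial, hence [E], hence 2. It is not 1 because
    [m < n], and if it is 2 then [n = 2 * m], the central case. *)
Lemma binomial_ndvd (n m E : nat) : 7 <= n -> 0 < m < n ->
    (forall q, q %| n -> q %| E -> q %| 2) ->
    (forall q, q %| n - 3 -> q %| E -> q %| 4) ->
  ~~ ('C(n, m) %| E).
Proof.
move=> n_ge7 /andP[m_gt0 ltmn] E0 E3; apply/negP => CE.
have n_gt0 : 0 < n by lia.
have nC : n %| m * 'C(n, m).
  by have := mul_bin_diag n m.-1; rewrite prednK // => <-; rewrite dvdn_mulr.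
have := dvdn_div_gcd _ _ _ n_gt0 nC; set q := _ %/ _ => qC.
have qn : q %| n by rewrite /q dvdn_div ?dvdn_gcdl.
have q2 : q %| 2 by apply: E0 => //; apply: dvdn_trans CE.
have nE : n = q * gcdn n m by rewrite divnK ?dvdn_gcdl.
have gm : gcdn n m <= m by rewrite dvdn_leq ?dvdn_gcdr.
have [q1|qeq2] : q = 1 \/ q = 2.
  by have := dvdn_leq (ltn0Sn 1) q2; case: (q) q2 => [|[|[|]]] //; [left|right].
  by move: ltmn; rewrite nE q1 mul1n ltnNge gm.
have mE : n = 2 * m.
  have /dvdnP[c mc] := dvdn_gcdr n m.
  move: nE; rewrite qeq2 => nE; have : c * gcdn n m < 2 * gcdn n m by rewrite -mc -nE.
  by rewrite ltn_mul2r => /andP[_]; case: c mc => [|[|]] // mc; clear -mc nE m_gt0; lia.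
have := central_binomial_ndvd m E; rewrite -mE => /(_ n_ge7 E3)/negP; apply.
exact: dvdn_mull.
Qed.

Lemma power_of_prime_divisors (p n : nat) : 0 < n ->
  (forall q, prime q -> q %| n -> q = p) -> exists w, n = p ^ w.
Proof.
move=> n_gt0 np; have /p_natP[w ->] : p.-nat n.
  by apply/pnatP => // q q_pr qn; rewrite inE /=; apply/eqP; apply: np.
by exists w.
Qed.

Lemma odd_prime_ne3_ge5 (q : nat) : prime q -> odd q -> q != 3 -> 5 <= q.
Proof. by case: q => [|[|[|[|[|]]]]]. Qed.

Lemma modn_subn_small (n k p : nat) : k <= n -> k < p -> p %| n - k -> n %% p = k.
Proof.
move=> lekn ltkp /eqP pnk.
by rewrite -(subnK lekn) -modnDml pnk add0n modn_small.
Qed.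

Lemma pow3_succ_neq0_mod8 (s : nat) : ~~ (8 %| (3 ^ s).+1).
Proof.
suff : 3 ^ s %% 8 \in [:: 1; 3].
  by rewrite /dvdn -[(3 ^ s).+1]addn1 -modnDml !inE => /orP[]/eqP->.
by elim: s => // s; rewrite expnS -modnMmr !inE => /orP[]/eqP->.
Qed.

(** * Excluding [k] blocks of size [d]; [W] is the number of such partitions *)

Section Blocks.

Variables (n k d W E : nat).
Hypotheses (n_ge7 : 7 <= n) (nE : n = k * d) (k_gt1 : 1 < k) (d_gt1 : 1 < d).
Hypotheses (WE : W * (k`! * d`! ^ k) = n`!) (W_dvd : W %| E).
Hypothesis E0 : forall q, q %| n -> q %| E -> q %| 2.
Hypothesis E3 : forall q, q %| n - 3 -> q %| E -> q %| 4.
Hypothesis E4 : forall q, q %| n - 4 -> q %| E -> q %| 6.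

Let logn_blocks p : prime p -> ~~ (p %| E) ->
  logn p (k * d)`! = k * logn p d`! + logn p k`!.
Proof.
move=> p_pr pE; have W_gt0 : 0 < W.
  by have := fact_gt0 n; rewrite -WE; case: (W).
have pW : logn p W = 0.
  have /negPf pW : ~~ (p %| W) by apply: contra pE => /dvdn_trans; apply.
  by rewrite lognE pW !andbF.
by rewrite -nE -WE !lognM ?muln_gt0 ?fact_gt0 ?expn_gt0 ?fact_gt0 // lognX pW add0n addnC.
Qed.

Let block_power p : prime p -> ~~ (p %| E) -> p <= k -> exists w, d = p ^ w.+1.
Proof.
move=> p_pr pE lepk; have [||w dE] := @pfactor_of_logn_fact p k d p_pr _ lepk.
- exact: ltnW.
- by rewrite addnC logn_blocks.
by case: w dE d_gt1 => [->|w ->] // _; exists w.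
Qed.

Let block_mod p : prime p -> ~~ (p %| E) -> k < p -> n %% p = k * (d %% p).
Proof.
move=> p_pr pE ltkp; rewrite nE; apply: modn_mul_of_logn_fact => //.
by rewrite logn_blocks // [logn p k`!](_ : _ = 0) ?addn0 // logn_fact_div // divn_small // logn1.
Qed.

Let ndvd3 p : prime p -> odd p -> p %| n - 3 -> ~~ (p %| E).
Proof.
move=> p_pr p_odd pn; apply/negP => /(E3 _ pn); rewrite -[4]/(2 ^ 2).
by rewrite Euclid_dvdX // andbT dvdn_prime2 // => /eqP p2; rewrite p2 in p_odd.
Qed.

Let ndvd4 p : prime p -> 5 <= p -> p %| n - 4 -> ~~ (p %| E).
Proof.
move=> p_pr p_ge5 pn; apply/negP => /(E4 _ pn); rewrite -[6]/(2 * 3).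
by rewrite Euclid_dvdM // !dvdn_prime2 // => /orP[]/eqP p2; rewrite p2 in p_ge5.
Qed.

Let ndvd0 : 3 %| n -> ~~ (3 %| E).
Proof. by move=> n3; apply/negP => /(E0 _ n3). Qed.

Let k_neq2 : k != 2.
Proof.
apply/negP => /eqP k2; have nE2 : n = 2 * d by rewrite nE k2.
have := central_binomial_ndvd d E; rewrite -nE2 => /(_ n_ge7 E3)/negP; apply.
suff -> : 'C(n, d) = 2 * W by rewrite dvdn_pmul2l.
have ledn : d <= n by rewrite nE leq_pmull // ltnW.
have nd : n - d = d by rewrite nE2 mul2n -addnn addnK.
apply/eqP; rewrite -(@eqn_pmul2r (d`! * d`!)) ?muln_gt0 ?fact_gt0 //.
by have := bin_fact ledn; rewrite nd -WE k2 => ->; apply/eqP; rewrite (_ : 2`! = 2) //; ring.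
Qed.

(** Here [n] is 3 modulo [p]. If [p <= k] then [d] is a positive power of [p], so [p] divides [n];
    otherwise [3 = k * (d %% p)]. *)
Let prime3 p : prime p -> 5 <= p -> p %| n - 3 -> k = 3.
Proof.
move=> p_pr p_ge5 pn; have p_odd : odd p by case: (even_prime p_pr) p_ge5 => [->|].
have pE := ndvd3 p p_pr p_odd pn.
have n3 : n %% p = 3 by apply: modn_subn_small pn; [apply: leq_trans n_ge7|apply: leq_trans p_ge5].
case: (ltnP k p) => [ltkp|/(block_power _ p_pr pE)[w dE]].
  have := block_mod p p_pr pE ltkp; rewrite n3 => e3.
  have : k %| 3 ^ 1 by rewrite expn1 e3 dvdn_mulr.
  case/(dvdn_pfactor _ _ (isT : prime 3)) => [[|[|]]] // _ k3.
  by move: k_gt1; rewrite k3.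
by move: n3; rewrite nE dE expnSr mulnA modnMl.
Qed.

Let prime4 p : prime p -> 5 <= p -> p %| n - 4 -> k = 4.
Proof.
move=> p_pr p_ge5 pn; have pE := ndvd4 p p_pr p_ge5 pn.
have n4 : n %% p = 4 by apply: modn_subn_small pn => //; apply: leq_trans n_ge7.
case: (ltnP k p) => [ltkp|/(block_power _ p_pr pE)[w dE]].
  have := block_mod p p_pr pE ltkp; rewrite n4 => e4.
  have : k %| 2 ^ 2 by rewrite (_ : 2 ^ 2 = 4) // e4 dvdn_mulr.
  case/(dvdn_pfactor _ _ (isT : prime 2)) => [[|[|[|]]]] // _ k4.
  - by move: k_gt1; rewrite k4.
  - by move: k_neq2; rewrite k4.
by move: n4; rewrite nE dE expnSr mulnA modnMl.
Qed.

(** If [k = 3] then [d] is a power of 3, so [n - 4] is odd and prime to 3. A prime factor of it is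
    at least 5 and forces [k = 4]. *)
Let k_neq3 : k != 3.
Proof.
apply/negP => /eqP k3; have n3 : 3 %| n by rewrite nE k3 dvdn_mulr.
have [|w dE] := block_power 3 isT (ndvd0 n3); first by rewrite k3.
have n4_odd : odd (n - 4).
  by rewrite oddB ?(leq_trans _ n_ge7) // addbF nE k3 dE oddM oddX.
have n4_gt1 : 1 < n - 4 by rewrite ltn_subRL (leq_trans _ n_ge7).
pose p := pdiv (n - 4).
have p_pr : prime p by apply: pdiv_prime.
have pn : p %| n - 4 by apply: pdiv_dvd.
have : k = 4; last by rewrite k3.
apply: (prime4 p) => //; apply: odd_prime_ne3_ge5 => //; first exact: dvdn_odd pn n4_odd.
apply/negP => /eqP p3; have n4 := pn; rewrite p3 in n4.
have : 3 %| n - (n - 4) by rewrite dvdn_sub.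
by rewrite subKn // (leq_trans _ n_ge7).
Qed.

Let prime3_le p : prime p -> p %| n - 3 -> p <= 3.
Proof.
move=> p_pr pn; rewrite leqNgt; apply/negP => p_gt3.
have /eqP := k_neq3; apply; apply: (prime3 p) => //.
by case: p p_pr p_gt3 {pn} => [|[|[|[|[|]]]]].
Qed.

Let k_ge3 : 3 <= k.
Proof. by rewrite ltn_neqAle eq_sym k_neq2. Qed.

(* If [n - 3] is a power of 3 then [9] cannot divide [n], so the blocks have size 3. *)
Let block3 y : n - 3 = 3 ^ y -> d = 3.
Proof.
move=> n3E; have n_gt3 : 3 < n by apply: leq_trans n_ge7.
have y_gt1 : 1 < y.
  case: y n3E => [|[|//]] n3E; move: n_ge7; rewrite -(subnK (ltnW n_gt3)) n3E //.
have d9 : 9 %| n - 3 by rewrite n3E -[9]/(3 ^ 2) dvdn_exp2l.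
have n3 : 3 %| n.
  by rewrite -(subnK (ltnW n_gt3)) dvdn_add //; apply: dvdn_trans d9.
have [w dE] := block_power 3 isT (ndvd0 n3) k_ge3.
case: w dE => [|w] dE; first by rewrite dE expn1.
have n9 : 9 %| n by rewrite nE dE -[9]/(3 ^ 2) dvdn_mull // dvdn_exp2l.
have : 9 %| n - (n - 3) by rewrite dvdn_sub.
by rewrite subKn // ltnW.
Qed.

Let odd_part3 m : 0 < m -> odd m -> (forall q, prime q -> q %| m -> q <= 3) -> exists y, m = 3 ^ y.
Proof.
move=> m_gt0 m_odd le3; apply: power_of_prime_divisors => // q q_pr qm.
have := le3 q q_pr qm; have := dvdn_odd qm m_odd.
by case: q q_pr {qm} => [|[|[|[|]]]].
Qed.

Let even_part2 m : 0 < m -> ~~ (3 %| m) -> (forall q, prime q -> q %| m -> q <= 3) -> exists t, m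
  = 2 ^ t.
Proof.
move=> m_gt0 m3 le3; apply: power_of_prime_divisors => // q q_pr qm.
have := le3 q q_pr qm.
by case: q q_pr qm => [|[|[|[|]]]] // _ m3'; rewrite m3' in m3.
Qed.

Let not_dvd_succ m : 3 %| m -> ~~ (3 %| m.+1).
Proof. by move=> m3; have := dvdn_addr 1 m3; rewrite addn1 => ->. Qed.

(** [4] cannot divide [W], as it divides [n - 4] but not 6. Removing two blocks of size 3 exposes
    the six top factors of [n!]; there [n - 4] and [n - 2] supply at least [3 + 1] powers of 2, and
    only 2 are lost to the factorials of the two blocks. *)
Let not_pow2 j t : d = 3 -> k = j.+2 -> n - 4 = 2 ^ t.+3 -> False.
Proof.
move=> d3 kE n4E; have nE' : n = 3 * j + 6 by rewrite nE kE d3; clear; lia.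
have W_gt0 : 0 < W by have := fact_gt0 n; rewrite -WE; case: (W).
have d4 : ~~ (4 %| W).
  apply/negP => W4; have : 4 %| 6; last by [].
  apply: E4; last exact: dvdn_trans W_dvd.
  by rewrite n4E -[4]/(2 ^ 2) dvdn_exp2l.
case/negP: d4; rewrite -[4]/(2 ^ 2) pfactor_dvdn //.
have := logn_fact_block 2 3 0 j isT isT (leq0n j).
rewrite !mul0n fact0 logn1 add0n !addn0 (_ : logn 2 3`! = 1) // muln1 => lej.
have eqW : logn 2 n`! = logn 2 W + (logn 2 k + (logn 2 k.-1 + logn 2 j`!) + k).
  rewrite -WE (lognM _ W_gt0) ?muln_gt0 ?expn_gt0 ?fact_gt0 //.
  rewrite (lognM _ (fact_gt0 k)) ?expn_gt0 ?fact_gt0 // lognX d3.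
  rewrite (_ : logn 2 3`! = 1) // muln1 kE 2!factS.
  by rewrite (lognM _ (ltn0Sn _)) ?muln_gt0 ?fact_gt0 // (lognM _ (ltn0Sn _)) ?fact_gt0 // addnA.
have eqF : logn 2 n`! = logn 2 k + (logn 2 (n - 1) + (logn 2 (n - 2) +
    (logn 2 k.-1 + (logn 2 (n - 4) + (logn 2 (n - 5) + logn 2 (j * 3)`!))))).
  have -> : n`! = (3 * k) * ((n - 1) * ((n - 2) * ((3 * k.-1) * ((n - 4) * ((n - 5) * (j *
    3)`!))))).
    have -> : 3 * k = (j * 3).+4.+2 by rewrite kE; clear; lia.
    have -> : 3 * k.-1 = (j * 3).+3 by rewrite kE; clear; lia.
    have -> : n = (j * 3).+4.+2 by rewrite nE'; clear; lia.
    by rewrite 6!factS.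
  have pos m : m <= 6 -> 0 < n - m by move=> le_m; rewrite subn_gt0 (leq_ltn_trans le_m).
  have k_gt0 : 0 < 3 * k by rewrite kE.
  have k1_gt0 : 0 < 3 * k.-1 by rewrite kE.
  by rewrite !lognM ?muln_gt0 ?k_gt0 ?k1_gt0 ?pos ?fact_gt0 ?kE.
move: eqF; rewrite eqW n4E pfactorK // => eqF.
have n2 : 0 < logn 2 (n - 2).
  rewrite logn_gt0 mem_primes subn_gt0 (leq_trans _ n_ge7) //=.
  have -> : n - 2 = n - 4 + 2 by clear -n_ge7; lia.
  by rewrite n4E dvdn_addr // expnS dvdn_mulr.
rewrite kE in eqF; clear -eqF n2 lej; lia.
Qed.

Lemma blocks_False : False.
Proof.
have n_gt4 : 4 < n by apply: leq_trans n_ge7.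
have n4S : (n - 4).+1 = n - 3 by rewrite -subSn ?subSS // ltnW.
have n3S : (n - 3) + 3 = n by rewrite subnK // ltnW // ltnW.
have odd34 : odd (n - 3) = ~~ odd (n - 4) by rewrite -n4S.
have n3_gt0 : 0 < n - 3 by rewrite -n4S.
(* A prime above 4 dividing [n - 4] gives [k = 4]; then [n - 3] is odd, hence a power of 3, so
   [d = 3] and [n - 4 = 8], which is absurd. *)
have [/hasP[p]|] := boolP (has (fun p => 4 < p) (primes (n - 4))).
  rewrite mem_primes => /and3P[p_pr _ pn] p_ge5.
  have k4 := prime4 p p_pr p_ge5 pn.
  have n3_odd : odd (n - 3) by rewrite oddB ?nE ?k4 ?oddM // -k4 -nE ltnW // ltnW.
  have [y /block3 d3] := odd_part3 (n - 3) n3_gt0 n3_odd prime3_le.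
  move: pn; rewrite nE k4 d3 -[4 * 3 - 4]/(2 ^ 3) Euclid_dvdX // andbT dvdn_prime2 //.
  by move/eqP=> p2; rewrite p2 in p_ge5.
rewrite -all_predC => /allP no4.
have n4_gt0 : 0 < n - 4 by rewrite subn_gt0.
have prime4_le q : prime q -> q %| n - 4 -> q <= 3.
  move=> q_pr qn; have : q \in primes (n - 4) by rewrite mem_primes q_pr n4_gt0.
  by move/no4; rewrite /= -leqNgt; case: q q_pr {qn} => [|[|[|[|[|]]]]].
have n3_gt3 : 3 < n - 3 by rewrite ltn_subRL.
(* Now [n - 4] and [n - 3] are consecutive without prime factors above 3, so one is a power of 2 and
   the other a power of 3. *)
have [n4_odd|n4_even] := boolP (odd (n - 4)).
  have [[|s] n4E] := odd_part3 _ n4_gt0 n4_odd prime4_le.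
    by move: n3_gt3; rewrite -n4S n4E.
  have [t n3E] : exists t, n - 3 = 2 ^ t.
    by apply: even_part2 => //; rewrite -n4S not_dvd_succ // n4E expnS dvdn_mulr.
  have tE : 2 ^ t = (3 ^ s.+1).+1 by rewrite -n3E -n4S n4E.
  have := pow3_succ_neq0_mod8 s.+1; rewrite -tE => t8.
  have t_le2 : t <= 2.
    by rewrite leqNgt; apply: contra t8 => t_gt2; rewrite -[8]/(2 ^ 3) dvdn_exp2l.
  have n7 : n = 7.
    have : n - 3 <= 4 by rewrite n3E -[4]/(2 ^ 2) leq_exp2l.
    by clear -n_ge7; lia.
  have d_le2 : d <= 2.
    by rewrite leqNgt; apply/negP => d_gt2; have := leq_mul k_ge3 d_gt2; rewrite -nE n7.
  have d2 : d = 2 by apply/eqP; rewrite eqn_leq d_le2 d_gt1.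
  have n_even : odd n = false by rewrite nE d2 oddM andbF.
  by rewrite n7 in n_even.
have n3_odd : odd (n - 3) by rewrite odd34.
have [[|s] n3E] := odd_part3 _ n3_gt0 n3_odd prime3_le.
  by move: n3_gt3; rewrite n3E.
have n4_3 : ~~ (3 %| n - 4).
  by apply/negP => /not_dvd_succ; rewrite n4S n3E expnS dvdn_mulr.
have [t n4E] := even_part2 _ n4_gt0 n4_3 prime4_le.
have d3 := block3 _ n3E.
case: t n4E => [|[|[|t]]] n4E; first 3 last.
- by apply: (not_pow2 k.-2 t d3 _ n4E); clear -k_ge3; lia.
- by move: n3_gt3; rewrite -n4S n4E.
- by move: n3_gt3; rewrite -n4S n4E.
have n8 : n = 8 by rewrite -n3S -n4S n4E.
have n3 : 3 %| n by rewrite nE d3 dvdn_mull.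
by rewrite n8 in n3.
Qed.

End Blocks.

(** An odd prime factor of [n - 3], or failing that a prime factor other than 3 of [n - 4], will do.
    If neither exists, [3^s + 1 = 2^t] with [t > 2], which is impossible modulo 8. *)
Lemma exists_odd_prime_ndvd (n E : nat) : 8 <= n ->
    (forall q, q %| n - 3 -> q %| E -> q %| 4) ->
    (forall q, q %| n - 4 -> q %| E -> q %| 6) ->
  exists p, [/\ prime p, 2 < p, p <= n - 3 & ~~ (p %| E)].
Proof.
move=> n_ge8 E3 E4.
have n3_gt0 : 0 < n - 3 by rewrite subn_gt0 (leq_trans _ n_ge8).
have n4_gt0 : 0 < n - 4 by rewrite subn_gt0 (leq_trans _ n_ge8).
have [/hasP[p]|] := boolP (has (fun p => p != 2) (primes (n - 3))).
  rewrite mem_primes => /and3P[p_pr _ pn] p2.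
  exists p; split=> //; first by rewrite ltn_neqAle eq_sym p2 prime_gt1.
    exact: dvdn_leq pn.
  apply/negP => /(E3 _ pn); rewrite -[4]/(2 ^ 2) Euclid_dvdX // andbT dvdn_prime2 //.
  exact/negP.
rewrite -all_predC => /allP no3.
have [|t n3E] := power_of_prime_divisors 2 (n - 3) n3_gt0.
  move=> q q_pr qn; have : q \in primes (n - 3) by rewrite mem_primes q_pr n3_gt0.
  by move/no3; rewrite /= negbK => /eqP.
have n4S : (n - 4).+1 = n - 3 by rewrite -subSn ?subSS // (leq_trans _ n_ge8).
have t_gt2 : 2 < t by rewrite -(ltn_exp2l _ _ (ltnSn 1)) -n3E ltn_subRL.
have [/hasP[p]|] := boolP (has (fun p => p != 3) (primes (n - 4))).
  rewrite mem_primes => /and3P[p_pr _ pn] p3.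
  have p_odd : odd p.
    apply: dvdn_odd pn _; rewrite -[odd _]negbK -[~~ odd _]/(odd (n - 4).+1) n4S n3E.
    by rewrite oddX; case: (t) t_gt2.
  have p_ge5 := odd_prime_ne3_ge5 _ p_pr p_odd p3.
  exists p; split=> //; first by apply: leq_trans p_ge5.
    by rewrite -n4S ltnW // ltnS dvdn_leq.
  apply/negP => /(E4 _ pn); rewrite -[6]/(2 * 3) Euclid_dvdM // !dvdn_prime2 // (negPf p3) orbF.
  by move/eqP=> p2; rewrite p2 in p_odd.
rewrite -all_predC => /allP no4.
have [|s n4E] := power_of_prime_divisors 3 (n - 4) n4_gt0.
  move=> q q_pr qn; have : q \in primes (n - 4) by rewrite mem_primes q_pr n4_gt0.
  by move/no4; rewrite /= negbK => /eqP.
by have := pow3_succ_neq0_mod8 s; rewrite -n4E n4S n3E -[8]/(2 ^ 3) dvdn_exp2l.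
Qed.

End BlockArithmetic.

(** * Primitivity *)

Section Primitivity.

Local Open Scope group_scope.

Variables (n : nat) (G : {group 'S_n}) (E : nat).
Hypothesis n_ge7 : 7 <= n.
Hypothesis index_dvd : #|[set: 'S_n] : G| %| E.
Hypothesis E0 : forall q, q %| n -> q %| E -> q %| 2.
Hypothesis E3 : forall q, q %| n - 3 -> q %| E -> q %| 4.
Hypothesis E4 : forall q, q %| n - 4 -> q %| E -> q %| 6.

(** A proper orbit of size [m] would make ['C(n, m)] divide the index, hence [E]. *)
Lemma transitive_of_index_dvd : [transitive G, on setT | 'P].
Proof.
have n_gt0 : 0 < n by apply: leq_trans n_ge7.
pose x := Ordinal n_gt0; pose O := orbit 'P G x.
have nOG : [acts G, on O | 'P] by apply: acts_orbit; apply: subsetT.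
have Ox : x \in O by apply: orbit_refl.
have [ltO|] := ltnP #|O| n.
  have := invariant_set_dvd_index _ _ _ nOG; rewrite card_ord => /dvdn_trans/(_ index_dvd).
  by rewrite (negPf (binomial_ndvd n #|O| E n_ge7 _ E0 E3)) // ltO andbT; apply/card_gt0P; exists x.
move=> le_nO; apply/imsetP; exists x => //; apply/esym/eqP.
by rewrite eqEcard subsetT cardsT card_ord.
Qed.

Lemma primitive_of_index_dvd : [primitive G, on setT | 'P].
Proof.
have trG := transitive_of_index_dvd.
rewrite /primitive trG; apply/existsP => -[Q /and3P[partQ nQG /andP[Q_gt1 Q_ltn]]].
have [/eqP covQ tiQ Q0] := and3P partQ.
have [B QB] : exists B, B \in Q by apply/card_gt0P; apply: leq_trans Q_gt1.
have nonempty C : C \in Q -> exists x, x \in C.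
  by move=> QC; apply/set0Pn; apply: contraNneq Q0 => <-.
have [x Bx] := nonempty B QB.
(* All blocks have equal size, since transitivity carries any block onto any other. *)
have dQ C : C \in Q -> #|C| = #|B|.
  move=> QC; have [y Cy] := nonempty C QC.
  have [g Gg yE] := atransP2 trG (in_setT x) (in_setT y).
  have QgB : 'P^*%act B g \in Q by rewrite (acts_act nQG).
  have gBy : y \in 'P^*%act B g by rewrite yE mem_setact.
  by rewrite -(def_pblock tiQ QC Cy) (def_pblock tiQ QgB gBy) card_setact.
have nE : n = (#|Q| * #|B|)%N.
  by rewrite -(card_uniform_partition dQ partQ) cardsT card_ord.
have B_gt1 : 1 < #|B|.
  move: Q_ltn; rewrite cardsT card_ord; move: nE; move: #|Q| #|B| => k d.
  by case: d => [|[|//]] -> ; rewrite ?muln0 ?muln1 ?ltnn.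
have /dvdnP[q oG] := partition_dvd_index _ _ _ _ partQ nQG dQ.
have /dvdnP[W WE] := fact_blocks_dvdn #|Q| #|B| (ltnW B_gt1).
rewrite -nE in WE; move/esym in WE.
apply: (blocks_False n #|Q| #|B| W E) => //.
apply: dvdn_trans index_dvd; apply/dvdnP; exists q.
apply/eqP; rewrite -(eqn_pmul2l (cardG_gt0 G)) Lagrange ?subsetT // cardsT card_Sn -WE oG.
by apply/eqP; ring.
Qed.

End Primitivity.

Set Implicit Arguments.
Unset Strict Implicit.

(** * Jordan's theorem *)

Section Jordan.

Local Open Scope group_scope.

Variable T : finType.
Implicit Types (G H : {group {perm T}}) (D S : {set T}) (s g h : {perm T}).

(** Jordan's argument starts from a small [D] on which this subgroup is primitive and enlarges [D]
    to all of [T]. *)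
Definition fix_outside G D : {group {perm T}} := 'C_G(~: D | 'P)%G.

Lemma fix_outsideP G D s :
  reflect (s \in G /\ perm_on D s) (s \in fix_outside G D).
Proof.
rewrite inE; apply: (iffP andP) => -[Gs Ds]; split=> //.
  apply/subsetP => x; rewrite inE; apply: contraR => Dx.
  by have /astabP/(_ x) := Ds; rewrite inE => /(_ Dx) /= /eqP.
by apply/astabP => x; rewrite inE => /(out_perm Ds).
Qed.

Lemma fix_outsideS G D S : D \subset S -> fix_outside G D \subset fix_outside G S.
Proof.
move=> sDS; apply/subsetP => s /fix_outsideP[Gs Ds]; apply/fix_outsideP; split=> //.
exact: subset_trans sDS.
Qed.

Lemma fix_outsideT G : fix_outside G setT = G.
Proof.
apply/val_inj/setP => s; apply/fix_outsideP/idP => [[]|Gs] //; split=> //.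
by apply/subsetP => x _; rewrite inE.
Qed.

Lemma fix_outside_acts G D : [acts fix_outside G D, on D | 'P].
Proof.
by apply/actsP => s /fix_outsideP[_ Ds] x; apply: perm_closed.
Qed.

Lemma fix_outsideJ G D s g :
  g \in G -> s \in fix_outside G D -> s ^ g \in fix_outside G (g @: D).
Proof.
move=> Gg /fix_outsideP[Gs Ds]; apply/fix_outsideP; split; first by rewrite groupJ.
apply/subsetP => x; rewrite inE -[x](permKV g) permJ (inj_eq perm_inj) => sx.
by apply/imset_f/(subsetP Ds).
Qed.

Lemma fix_outside_stab G D (a : T) :
  a \notin D -> 'C_(fix_outside G (a |: D))[a | 'P] = fix_outside G D.
Proof.
move=> Da; apply/setP => s; rewrite inE; apply/andP/fix_outsideP.
  move=> [/fix_outsideP[Gs Ds] /astab1P /= sa]; split=> //.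
  apply/subsetP => x sx; have := subsetP Ds x sx.
  by rewrite !inE => /predU1P[xa|//]; move: sx; rewrite xa inE -[s a]/(aperm a s) sa eqxx.
move=> [Gs Ds]; split; last by apply/astab1P; apply: out_perm Ds Da.
by apply/fix_outsideP; split=> //; apply: subset_trans (subsetUr _ _).
Qed.

(** Point stabilisers have prime index, hence are maximal. *)
Lemma transitive_prime_primitive H S :
  prime #|S| -> [transitive H, on S | 'P] -> [primitive H, on S | 'P].
Proof.
move=> S_pr trH; have [x Sx _] := imsetP trH.
rewrite (trans_prim_astab Sx trH); apply/orP; right.
apply: p_index_maximal; first exact: subsetIl.
by rewrite -card_orbit (atransP trH).
Qed.

(* Otherwise [D] would be a block. *)
Lemma primitive_moves_set H S D :
    [primitive H, on S | 'P] -> D \subset S -> 1 < #|D| -> D != S ->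
  exists h, [/\ h \in H, D :&: h @: D != set0 & h @: D != D].
Proof.
move=> primH sDS D_gt1 D_neqS; have [trH _] := andP primH.
have [x Dx] : exists x, x \in D by apply/card_gt0P; apply: ltnW.
have Sx := subsetP sDS x Dx.
suff /exists_inP[h Hh /andP[h1 h2]] :
  [exists (h | h \in H), (D :&: h @: D != set0) && (h @: D != D)] by exists h.
apply: contraT; rewrite negb_exists_in => /forall_inP noh.
have block h y : h \in H -> y \in D -> h y \in D -> h \in 'N_H(D | 'P).
  move=> Hh Dy Dhy; rewrite inE Hh -astab1_set; apply/astab1P => /=.
  have := noh h Hh; rewrite negb_and !negbK => /orP[|/eqP //].
  by move/eqP/setP/(_ (h y)); rewrite !inE Dhy imset_f.
have := primH; rewrite (trans_prim_astab Sx trH) => /maximal_eqP[_ maxC].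
have sCN : 'C_H[x | 'P] \subset 'N_H(D | 'P).
  apply/subsetP => h /setIP[Hh /astab1P /= hx]; apply: (block h x) => //.
  by rewrite -[h x]/(aperm x h) hx.
have [] := maxC 'N_H(D | 'P)%G sCN (subsetIl _ _) => /= NE.
  have D1 : D \subset [set x].
    apply/subsetP => y Dy; have [h Hh yE] := atransP2 trH Sx (subsetP sDS y Dy).
    have : h \in 'N_H(D | 'P) by apply: (block h x); rewrite -?[h x]/('P%act x h) -?yE.
    by rewrite NE => /setIP[_ /astab1P hx]; rewrite inE yE hx.
  by have := subset_leq_card D1; rewrite cards1 leqNgt D_gt1.
case/eqP: D_neqS; apply/eqP; rewrite eqEsubset sDS; apply/subsetP => y Sy.
have [h Hh ->] := atransP2 trH Sx Sy.
by move: Hh; rewrite -NE => /setIP[_ nDh]; rewrite (astabs_act _ nDh).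
Qed.

Section Step.

Variables (G : {group {perm T}}) (D : {set T}).
Hypotheses (primG : [primitive G, on setT | 'P]) (D_gt1 : 1 < #|D|).
Hypothesis primD : [primitive fix_outside G D, on D | 'P].

(** Among the translates of [D] that meet [D] and differ from it, take one with the fewest points
    outside [D]. Primitivity on [D] forces a single such point [a], and the conjugated subgroup
    links [a] to [D]. *)
Lemma primitive_extend : D != setT ->
  exists2 a, a \notin D & [transitive fix_outside G (a |: D), on a |: D | 'P].
Proof.
move=> D_neqT; have [trD _] := andP primD.
pose meets g := [&& g \in G, D :&: g @: D != set0 & g @: D != D].
have [g0 g0P] : exists g, meets g.
  have [g [Gg g1 g2]] := primitive_moves_set primG (subsetT D) D_gt1 D_neqT.
  by exists g; apply/and3P.
case: (arg_minnP (fun g : {perm T} => #|g @: D :\: D|) g0P) => g /and3P[Gg Dg gD] min_g.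
set Y := g @: D :\: D.
have card_im s : #|s @: D| = #|D| by apply: card_imset; apply: perm_inj.
have Y_gt0 : 0 < #|Y|.
  rewrite card_gt0; apply: contraNneq gD => Y0; rewrite eqEcard card_im leqnn andbT.
  by rewrite -setD_eq0 -/Y Y0.
have Y_ltD : #|Y| < #|D|.
  rewrite -(card_im g) -(cardsID D (g @: D)) -/Y -[ltnLHS]add0n ltn_add2r card_gt0 setIC.
  by [].
have Y1 : #|Y| <= 1.
  rewrite leqNgt; apply/negP => Y_gt1.
  pose Y' := [set x in D | g x \notin D].
  have YE : Y = g @: Y'.
    apply/setP => x; rewrite inE; apply/andP/imsetP.
      by move=> [Dx /imsetP[y Dy xE]]; exists y; rewrite ?inE ?Dy -?xE.
    by move=> [y]; rewrite inE => /andP[Dy Dgy] ->; rewrite imset_f.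
  have cardY : #|Y| = #|Y'| by rewrite YE card_imset //; apply: perm_inj.
  have sY'D : Y' \subset D by apply/subsetP => x; rewrite inE => /andP[].
  have Y'D : Y' != D by apply: contraTneq Y_ltD => Y'E; rewrite cardY Y'E ltnn.
  rewrite cardY in Y_gt1.
  have [h' [Fh' hY1 hY2]] := primitive_moves_set primD sY'D Y_gt1 Y'D.
  (* [h] acts on [g @: D] as [h'] acts on [D]. Since [h'] moves [Y'] to a set that meets it but
     differs from it, [h @: D] leaves [D] in fewer points than [g @: D], against minimality. *)
  pose h := h' ^ g.
  have hg x : h (g x) = g (h' x) by rewrite /h permJ.
  have [Gh on_h] := fix_outsideP _ _ _ (fix_outsideJ Gg Fh').
  have hDD : h @: D :\: D = Y :\: h @: Y.
    apply/setP => x; rewrite !in_setD -[x](permKV h) !mem_imset; try exact: perm_inj.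
    move: (h^-1 x) => {}x; rewrite (perm_closed _ on_h).
    rewrite /Y in_setD; case: (boolP (x \in g @: D)) => gx; rewrite ?andbT ?andbF ?negbK.
      by case: (x \in D); rewrite ?andbT ?andbF.
    by rewrite (out_perm on_h gx); case: (x \in D).
  have YhY : Y :&: h @: Y != set0.
    have [y /setIP[Yy /imsetP[z Yz yE]]] := set0Pn _ hY1.
    apply/set0Pn; exists (g y); rewrite YE inE imset_f //= yE -hg.
    by rewrite !imset_f.
  have ltY : #|h @: D :\: D| < #|Y|.
    by rewrite hDD -(cardsID (h @: Y) Y) -[ltnLHS]add0n ltn_add2r card_gt0.
  have meets_h : meets h.
    rewrite /meets Gh /=; apply/andP; split.
      apply: contraTneq (ltn_trans ltY Y_ltD) => Dh.
      by rewrite -leqNgt -(card_im h) -(cardsID D (h @: D)) [_ :&: D]setIC Dh cards0.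
    apply: contraNneq hY2 => hD; apply/eqP.
    have : #|Y :\: h @: Y| == 0 by rewrite -hDD hD setDv cards0.
    rewrite cards_eq0 setD_eq0 => sY.
    have hYE : h @: Y = g @: (h' @: Y').
      by rewrite YE -!imset_comp; apply: eq_imset => x /=; rewrite hg.
    apply: (imset_inj (@perm_inj _ g)); rewrite -hYE -YE; apply/esym/eqP.
    by rewrite eqEcard sY card_imset ?leqnn //; apply: perm_inj.
  by have := min_g h meets_h; rewrite leqNgt ltY.
have /cards1P[a YE] : #|Y| == 1%N by rewrite eqn_leq Y1.
have /setDP[Da nDa] : a \in Y by rewrite YE set11.
exists a => //.
have sgD : g @: D \subset a |: D.
  by apply/subsetP => x gx; rewrite !inE orbC; case: (boolP (x \in D)) => //= Dx;
    rewrite -in_set1 -YE inE Dx.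
have [d /setIP[Dd gd]] := set0Pn _ Dg.
have sF : fix_outside G D \subset fix_outside G (a |: D) by apply/fix_outsideS/subsetUr.
apply/imsetP; exists d; first by rewrite inE Dd orbT.
apply/esym/eqP; rewrite eqEsubset acts_sub_orbit ?fix_outside_acts // setU1r //=.
apply/subsetP => x /setU1P[->|Dx].
  (* To reach [a] from [d], both in [g @: D], conjugate by [g] an element joining their preimages in
     [D]. *)
  case/imsetP: Da => a' Da' aE; case/imsetP: gd => d' Dd' dE.
  have [h Fh hE] := atransP2 trD Dd' Da'.
  apply/orbitP; exists (h ^ g); last by rewrite /= /aperm dE permJ -[h d']/('P%act d' h) -hE.
  exact: subsetP (fix_outsideS G sgD) _ (fix_outsideJ Gg Fh).
have [h Fh hE] := atransP2 trD Dd Dx.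
by apply/orbitP; exists h => //; apply: (subsetP sF).
Qed.

End Step.

Lemma transitive_ntransitive1 H S :
  [transitive H, on S | 'P] -> [transitive^1 H, on S | 'P].
Proof.
move=> trH; have [x Sx _] := imsetP trH.
exact: stab_ntransitiveI Sx trH (ntransitive0 _ _ _).
Qed.

Lemma ntransitive_extend G D a m :
    a \notin D -> [transitive fix_outside G (a |: D), on a |: D | 'P] ->
    [transitive^m fix_outside G D, on D | 'P] ->
  [transitive^m.+1 fix_outside G (a |: D), on a |: D | 'P].
Proof.
move=> Da trDa trD; apply: (stab_ntransitiveI (setU11 a D) trDa).
by rewrite setU1K // fix_outside_stab.
Qed.

(* The points outside [D] are added one at a time; the orbit-stabiliser steps contribute the
   factors [#|D| + 1], ..., [#|T|] to the order of [G]. *)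
Lemma primitive_card G D :
    [primitive G, on setT | 'P] -> 1 < #|D| -> [primitive fix_outside G D, on D | 'P] ->
  (#|G| * #|D|`! = #|T|`! * #|fix_outside G D|)%N.
Proof.
move=> primG; elim: {D}_.+1 {-2}D (ltnSn (#|T| - #|D|)) => // m IHm D le_m D_gt1 primD.
have [->|DnT] := eqVneq D setT; first by rewrite fix_outsideT cardsT mulnC.
have [a Da trDa] := primitive_extend primG D_gt1 primD DnT.
have cardDa : #|a |: D| = #|D|.+1 by rewrite cardsU1 Da.
have trD : [transitive fix_outside G D, on D | 'P] by case/andP: primD.
have primDa : [primitive fix_outside G (a |: D), on a |: D | 'P].
  exact: (ntransitive_primitive (isT : 1 < 2)%N (ntransitive_extend Da trDa
    (transitive_ntransitive1 trD))).
have ltDT : #|D| < #|T|.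
  by rewrite -cardsT proper_card // properT.
have le_Da : #|T| - #|a |: D| < m by rewrite cardDa subnS prednK ?subn_gt0 // -ltnS.
have Da_gt1 : 1 < #|a |: D| by rewrite cardDa ltnS ltnW.
have := IHm (a |: D) le_Da Da_gt1 primDa; rewrite cardDa => IH.
have := card_orbit_stab 'P (fix_outside G (a |: D)) a.
rewrite (atransP trDa) ?setU11 // cardDa fix_outside_stab // => oF.
by apply/eqP; rewrite -(eqn_pmul2l (ltn0Sn #|D|)) mulnCA -factS IH -oF mulnCA.
Qed.

End Jordan.

(** * Primitive groups containing a cycle of prime length *)

Section PrimeCycle.

Local Open Scope group_scope.

(** The order formula gives [#|G| * 3! = #|T|! * #|F|], where 3 divides the order of
    [F = fix_outside G D]; so the index times [#|F| / 3] is 2. *)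
Lemma index_dvd2_of_transitive3 (T : finType) (G : {group {perm T}}) (D : {set T}) :
    [primitive G, on setT | 'P] -> #|D| = 3 -> [transitive fix_outside G D, on D | 'P] ->
  #|[set: {perm T}] : G| %| 2.
Proof.
move=> primG D3 trD.
have primD : [primitive fix_outside G D, on D | 'P].
  by apply: transitive_prime_primitive trD; rewrite D3.
have /dvdnP[m oF] : 3 %| #|fix_outside G D| by rewrite -D3; apply: atrans_dvd trD.
have := primitive_card primG _ primD; rewrite D3 oF => /(_ isT) oG.
have := Lagrange (subsetT G); rewrite (card_Sym T) => oT.
apply/dvdnP; exists m; apply/eqP.
rewrite -(@eqn_pmul2r 3) // -(eqn_pmul2l (cardG_gt0 G)); apply/eqP.
by rewrite (_ : 2 * 3 = 3`!)%N // oG -oT; ring.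
Qed.

Variables (T : finType) (G : {group {perm T}}) (p : nat) (D : {set T}) (c : {perm T}).
Hypotheses (p_pr : prime p) (Gc : c \in G) (on_c : perm_on D c) (oc : #[c] = p).
Hypothesis D_p : #|D| = p.

Lemma cycle_transitive : [transitive <[c]>, on D | 'P].
Proof.
have c_neq1 : c != 1 by rewrite -order_gt1 oc prime_gt1.
have [x cx] : exists x, c x != x.
  apply/existsP; apply: contraNT c_neq1; rewrite negb_exists => /forallP c1.
  by apply/eqP/permP => x; rewrite perm1; apply/eqP; rewrite -[_ == _]negbK.
have Dx : x \in D by apply: (subsetP on_c).
have acts_c : [acts <[c]>, on D | 'P].
  apply/actsP => s /cycleP[i ->] y; rewrite /= /aperm; elim: i => [|i IHi].
    by rewrite expg0 perm1.
  by rewrite expgSr permM (perm_closed _ on_c).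
apply/imsetP; exists x => //; apply/esym/eqP; rewrite eqEcard acts_sub_orbit // Dx /=.
have : #|orbit 'P <[c]> x| %| p ^ 1 by rewrite expn1 -oc dvdn_orbit.
case/(dvdn_pfactor _ _ p_pr) => [[|[|]]] // _ oO; last by rewrite D_p oO expn1.
have : [set x; c x] \subset orbit 'P <[c]> x.
  by rewrite subUset !sub1set orbit_refl; apply/orbitP; exists c; rewrite ?cycle_id.
by move/subset_leq_card; rewrite oO expn0 cards2 eq_sym cx.
Qed.

Let P_F : <[c]> \subset fix_outside G D.
Proof. by rewrite cycle_subG; apply/fix_outsideP. Qed.

Lemma fix_outside_transitive : [transitive fix_outside G D, on D | 'P].
Proof.
have [x Dx _] := imsetP cycle_transitive.
apply/imsetP; exists x => //; apply/esym/eqP; rewrite eqEsubset acts_sub_orbit ?fix_outside_acts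
  // Dx /=.
apply/subsetP => y Dy; have [s cs ->] := atransP2 cycle_transitive Dx Dy.
by apply: mem_orbit; apply: subsetP P_F _ cs.
Qed.

(** The order of the ambient group divides [p!], in which [p] occurs exactly once. *)
Let sylP : p.-Sylow(fix_outside G D) <[c]>.
Proof.
rewrite pHallE P_F -orderE oc /=.
have dvd_p : #|fix_outside G D| %| p`!.
  rewrite -D_p -perm.card_Sym; apply: cardSg; apply/subsetP => s /fix_outsideP[_ Ds].
  by rewrite inE.
suff logF : logn p #|fix_outside G D| = 1%N by rewrite p_part logF expn1.
apply/eqP; rewrite eqn_leq -pfactor_dvdn // expn1 -{2}oc orderE cardSg // andbT.
apply: leq_trans (dvdn_leq_log p (fact_gt0 p) dvd_p) _.
by rewrite logn_fact_div // divnn prime_gt0 // logn1.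
Qed.

(* Frattini argument. *)
Let normalizing (s : {perm T}) : s \in G -> s @: D = D ->
  exists t, [/\ t \in G, t \in 'N(<[c]>) & forall x, x \notin D -> t x = s x].
Proof.
move=> Gs sD.
have cs : <[c ^ s]> \subset fix_outside G D.
  rewrite cycle_subG -sD; apply: fix_outsideJ => //; exact/fix_outsideP.
have sylPs : p.-Sylow(fix_outside G D) <[c ^ s]>.
  by rewrite pHallE cs /= -orderE orderJ orderE -(card_Hall sylP).
have [h Fh PE] := Sylow_trans sylPs sylP.
have [Gh on_h] := fix_outsideP _ _ _ Fh.
exists (s * h); split; first by rewrite groupM.
  by apply/normP; rewrite conjsgM -cycleJ -PE.
move=> x Dx; rewrite permM (out_perm on_h) //.
apply: contra Dx => Dsx; have : s x \in s @: D by rewrite sD.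
by rewrite mem_imset //; apply: perm_inj.
Qed.

Hypotheses (primG : [primitive G, on setT | 'P]) (p_gt3 : 3 < p) (p_le : p + 3 <= #|T|).

(* Add three points [a], [b], [e] to the support of [c]. Elements of [G] normalising [<[c]>]
   and inducing the transpositions [(a b)] and [(b e)] have a commutator that centralises [c],
   hence acts on [D] as a power of [c], and induces a 3-cycle on [{a, b, e}]; its
   [p ^ 2]-th power is a 3-cycle. *)
Lemma index_dvd2_of_prime_cycle : #|[set: {perm T}] : G| %| 2.
Proof.
have D_gt1 : 1 < #|D| by rewrite D_p prime_gt1.
have not_setT (S : {set T}) : #|S| < #|T| -> S != setT.
  by move=> ltS; apply: contraTneq ltS => ->; rewrite cardsT ltnn.
have trD := fix_outside_transitive.
have primD : [primitive fix_outside G D, on D | 'P].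
  by apply: transitive_prime_primitive trD; rewrite D_p.
have [|a Da trDa] := primitive_extend primG D_gt1 primD.
  by apply: not_setT; rewrite D_p; apply: leq_trans p_le; rewrite -addn1 leq_add2l.
have tr2 := ntransitive_extend Da trDa (transitive_ntransitive1 trD).
have cardDa : #|a |: D| = p.+1 by rewrite cardsU1 Da D_p.
have [||b Db trDb] := primitive_extend primG _ (ntransitive_primitive (isT : 1 < 2)%N tr2).
- by rewrite cardDa ltnS prime_gt0.
- by apply: not_setT; rewrite cardDa; apply: leq_trans p_le; rewrite -addn2 leq_add2l.
have tr3 := ntransitive_extend Db trDb tr2.
have cardDb : #|b |: (a |: D)| = p.+2 by rewrite cardsU1 Db cardDa.
have [||e De trDe] := primitive_extend primG _ (ntransitive_primitive (isT : 1 < 3)%N tr3).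
- by rewrite cardDb.
- by apply: not_setT; rewrite cardDb; apply: leq_trans p_le; rewrite -addn3 leq_add2l.
have tr4 := ntransitive_extend De trDe tr3.
move: Db De; rewrite !inE !negb_or => /andP[ba Db] /andP[eb /andP[ea De]].
have [s1 F1 [s1a s1b]] : exists2 s, s \in fix_outside G (b |: (a |: D)) & s a = b /\ s b = a.
  have tr := ntransitive_weak (isT : 2 <= 3)%N tr3.
  have t1 : [tuple a; b] \in 2.-dtuple(b |: (a |: D)).
    by rewrite !inE memtE subset_all /= !inE !eqxx ?orbT eq_sym ba.
  have t2 : [tuple b; a] \in 2.-dtuple(b |: (a |: D)).
    by rewrite !inE memtE subset_all /= !inE !eqxx ?orbT ba.
  by have [s Fs [/esym sa /esym sb]] := atransP2 tr t1 t2; exists s.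
have [s2 F2 [s2a s2b s2e]] : exists2 s, s \in fix_outside G (e |: (b |: (a |: D))) &
    [/\ s a = a, s b = e & s e = b].
  have tr := ntransitive_weak (isT : 3 <= 4)%N tr4.
  have t1 : [tuple a; b; e] \in 3.-dtuple(e |: (b |: (a |: D))).
    by rewrite !inE memtE subset_all /= !inE !eqxx ?orbT ![a == _]eq_sym [b == e]eq_sym (negPf
      ba) (negPf eb) (negPf ea).
  have t2 : [tuple a; e; b] \in 3.-dtuple(e |: (b |: (a |: D))).
    by rewrite !inE memtE subset_all /= !inE !eqxx ?orbT ![a == _]eq_sym (negPf ba) (negPf eb)
      (negPf ea).
  by have [s Fs [/esym sa /esym sb /esym se]] := atransP2 tr t1 t2; exists s.
have im_D (s : {perm T}) : (forall x, x \in D -> s x \in D) -> s @: D = D.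
  move=> sD; apply/eqP; rewrite eqEcard (card_imset _ (@perm_inj _ s)) leqnn andbT.
  by apply/subsetP => _ /imsetP[x Dx ->]; apply: sD.
have neqs (s : {perm T}) x y z : s y = z -> x \in D -> y \notin D -> s x != z.
  by move=> <- Dx Dy; rewrite (inj_eq perm_inj); apply: contraNneq Dy => <-.
have [Gs1 on_s1] := fix_outsideP _ _ _ F1.
have [Gs2 on_s2] := fix_outsideP _ _ _ F2.
have s1D : s1 @: D = D.
  apply: im_D => x Dx; have : s1 x \in b |: (a |: D) by rewrite (perm_closed _ on_s1) !inE Dx !orbT.
  by rewrite !inE (negPf (neqs _ _ _ _ s1a Dx Da)) (negPf (neqs _ _ _ _ s1b Dx Db)).
have s2D : s2 @: D = D.
  apply: im_D => x Dx; have : s2 x \in e |: (b |: (a |: D)) by rewrite (perm_closed _ on_s2) !inE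
    Dx !orbT.
  by rewrite !inE (negPf (neqs _ _ _ _ s2a Dx Da)) (negPf (neqs _ _ _ _ s2b Dx Db)) (negPf (neqs
    _ _ _ _ s2e Dx De)).
have [t1 [Gt1 Nt1 t1E]] := normalizing Gs1 s1D.
have [t2 [Gt2 Nt2 t2E]] := normalizing Gs2 s2D.
pose z := t1 * t2 * (t2 * t1)^-1.
have Gz : z \in G by rewrite groupM ?groupV ?groupM.
have zc : commute z c.
  (* Both [t1] and [t2] act on [<[c]>] by raising to powers, and such maps commute. *)
  have /cycleP[i ci] : c ^ t1 \in <[c]> by rewrite memJ_norm ?cycle_id.
  have /cycleP[j cj] : c ^ t2 \in <[c]> by rewrite memJ_norm ?cycle_id.
  apply/commute_sym/commgP/conjg_fixP; rewrite /z conjgM [c ^ (t1 * t2)]conjgM ci conjXg cj.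
  by rewrite -expgM mulnC expgM -ci -conjXg -cj -(conjgM c t2 t1) conjgK.
have inv x y : (t2 * t1) x = y -> (t2 * t1)^-1 y = x by move=> <-; rewrite permK.
have s1e : s1 e = e by rewrite (out_perm on_s1) // !inE !negb_or eb ea.
have [za zb ze] : [/\ z a = b, z b = e & z e = a].
  rewrite /z !permM !t1E ?s1a ?s1b ?s1e // !t2E // s2a s2b s2e.
  by split; apply: inv; rewrite permM t2E // ?s2a ?s2b ?s2e t1E.
have z_out x : x \notin e |: (b |: (a |: D)) -> z x = x.
  move=> x_out; move: (x_out); rewrite !inE !negb_or => /and4P[xe xb xa xD].
  have s1x : s1 x = x by rewrite (out_perm on_s1) // !inE !negb_or xb xa.
  have s2x : s2 x = x by apply: out_perm x_out.
  rewrite /z !permM t1E // s1x t2E // s2x; apply: inv.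
  by rewrite permM t2E // s2x t1E.
have zD x : x \in D -> (z ^+ p) x = x.
  move=> Dx; have Dz y : y \in D -> z y \in D.
    move=> Dy; have [|zy] := boolP (z y \in e |: (b |: (a |: D))).
      by rewrite !inE (negPf (neqs _ _ _ _ za Dy Da)) (negPf (neqs _ _ _ _ zb Dy Db)) (negPf
        (neqs _ _ _ _ ze Dy De)).
    by move/perm_inj: (z_out _ zy) => zyE; rewrite zyE.
  have [_ /cycleP[i ->] zx] := atransP2 cycle_transitive Dx (Dz x Dx).
  (* Because [z] commutes with [c ^+ i], their agreement at the one point [x] propagates to all
     powers. *)
  have zcx k : (z ^+ k) x = (c ^+ i ^+ k) x.
    elim: k => [|k IHk]; first by rewrite !expg0.
    rewrite expgSr permM IHk -permM -(commuteX k (commuteX i zc)) permM.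
    by rewrite zx /= /aperm -permM -expgS.
  by rewrite zcx -expgM mulnC expgM -oc expg_order expg1n perm1.
(* As [p ^ 2] is 1 modulo 3, [w] agrees with [z] on [a], [b], [e], while it is trivial on [D]. *)
have p3 : (p * p) %% 3 = 1%N.
  rewrite -modnMml -modnMmr; have : p %% 3 != 0 by rewrite -[_ == 0]/(3 %| p) dvdn_prime2 //
    neq_ltn p_gt3.
  by have := ltn_pmod p (isT : 0 < 3); case: (p %% 3) => [|[|[|]]].
pose w := z ^+ (p * p).
have z3 x : x \in [set a; b; e] -> (z ^+ 3) x = x.
  by rewrite !inE => /orP[/orP[]|] /eqP->; rewrite permX /= ?za ?zb ?ze ?za ?zb ?ze ?za ?zb.
have wE x : x \in [set a; b; e] -> w x = z x.
  move=> abx; rewrite /w (divn_eq (p * p) 3) p3 expgD expg1 permM mulnC expgM.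
  by rewrite permX_fix ?z3.
have Fw : w \in fix_outside G [set a; b; e].
  apply/fix_outsideP; split; first by rewrite groupX.
  apply/subsetP => x; rewrite inE; apply: contraR => abx; apply/eqP.
  have [Dx|Dx] := boolP (x \in D); first by rewrite /w expgM permX_fix ?zD.
  apply: permX_fix; apply: z_out; move: abx; rewrite !inE !negb_or (negPf Dx) andbT.
  by case/andP=> /andP[-> ->] ->.
apply: (@index_dvd2_of_transitive3 T G [set a; b; e]) => //.
  by rewrite setUC cardsU1 cards2 !inE negb_or ea eb eq_sym ba.
have abe_a : a \in [set a; b; e] by rewrite !inE eqxx.
have abe_b : b \in [set a; b; e] by rewrite !inE eqxx orbT.
apply/imsetP; exists a => //; apply/esym/eqP; rewrite eqEsubset acts_sub_orbit ?fix_outside_acts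
  // abe_a /=.
apply/subsetP => x; rewrite !inE => /orP[/orP[]|] /eqP->.
- exact: orbit_refl.
- by apply/orbitP; exists w => //=; rewrite /aperm wE.
- by apply/orbitP; exists (w * w); rewrite ?groupM //= /aperm permM !wE ?za ?zb.
Qed.

End PrimeCycle.

(** * Prime cycles from the index; indices one and two *)

Section IndexTwo.

Import GRing.Theory.
Local Open Scope group_scope.

(* A subgroup of index prime to [p] contains a Sylow [p]-subgroup of the symmetric group,
   hence a conjugate of every element of order [p]. *)
Lemma exists_prime_cycle (T : finType) (G : {group {perm T}}) (p : nat) :
    prime p -> p <= #|T| -> ~~ (p %| #|[set: {perm T}] : G|) ->
  exists D c, [/\ c \in G, perm_on D c, #[c] = p & #|D| = p].
Proof.
move=> p_pr lepT pK.
have [D0 D0_p] : exists D0 : {set T}, #|D0| = p.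
  have : 0 < #|[set A : {set T} | #|A| == p]| by rewrite card_draws bin_gt0.
  by case/card_gt0P => D0; rewrite inE => /eqP; exists D0.
have [c0 /[!inE] on_c0 oc0] : {c | c \in perm.Sym D0 & #[c] = p}.
  by apply: Cauchy => //; rewrite perm.card_Sym D0_p dvdn_fact // prime_gt0 //=.
have [P sylP] := Sylow_exists p G.
have sylT : p.-Sylow([set: {perm T}]) P.
  rewrite pHallE subsetT /= (card_Hall sylP) -(Lagrange (subsetT G)).
  by rewrite partnM ?cardG_gt0 // (part_p'nat (n := #|_ : G|)) ?muln1 // p'natE.
have [|x _ cP] := Sylow_subJ sylT (subsetT <[c0]>).
  by rewrite /pgroup -orderE oc0 pnat_id.
exists (x^-1 @: D0), (c0 ^ x^-1); split.
- by rewrite (subsetP (pHall_sub sylP)) // -mem_conjg -cycle_subG.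
- apply/subsetP => y; rewrite inE -[y](permKV x^-1) permJ (inj_eq perm_inj) => cy.
  by apply/imset_f/(subsetP on_c0).
- by rewrite orderJ.
- by rewrite card_imset //; apply: perm_inj.
Qed.

(** [G] is normal, so it meets the simple group ['Alt_T] trivially or contains it. The trivial case
    would give a product set larger than the symmetric group. *)
Lemma Alt_of_index2 (T : finType) (G : {group {perm T}}) :
  5 <= #|T| -> #|[set: {perm T}] : G| = 2 -> G :=: 'Alt_T.
Proof.
move=> T_ge5 iG; have T_gt1 : 1 < #|T| by apply: leq_trans T_ge5.
have nG : G <| [set: {perm T}] by apply: index2_normal => //; apply: subsetT.
have oG : (#|G| * 2 = #|T|`!)%N by rewrite -iG Lagrange ?subsetT //; apply: card_Sym.
have oA := card_Alt T_gt1.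
have /simpleP[_ sA] := simple_Alt5 T_ge5.
have [] := sA (G :&: 'Alt_T)%G.
- by apply: normalS (subsetIr _ _) (subsetT _) _; apply: normalI => //; apply: Alt_normal.
- move=> /= GA1; have : #|G * 'Alt_T| <= #|[set: {perm T}]| by rewrite subset_leq_card ?subsetT.
  have := mul_cardG G 'Alt_T; rewrite GA1 cards1 muln1 => <-.
  rewrite (card_Sym T).
  have := leq_trans T_ge5 (fact_geq #|T|).
  move: oG oA; move: #|G| #|'Alt_T| (#|T|`!) => g a f oG oA f_ge5.
  have -> : a = g by lia.
  by rewrite -oG leq_pmul2l; lia.
- move=> /= GA; apply/eqP; rewrite eq_sym eqEcard -{1}GA subsetIl /=.
  by rewrite -(leq_pmul2l (isT : 0 < 2)) oA mulnC oG.
Qed.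

(** For index 1 the coset is everything, so the signed count of derangements, [n - 1] up to sign,
    would vanish. *)
Lemma index_neq1 (n : nat) (G : {group 'S_n}) (C : {set 'S_n}) :
  1 < n -> #|C| = #|G| -> derangement_ratio C = derangement_ratio 'Alt_('I_n) ->
  #|[set: 'S_n] : G| != 1%N.
Proof.
move=> n_gt1 oC ratio; apply/eqP => iG.
have := derangements_mul_index _ _ _ n_gt1 oC ratio; rewrite iG muln1.
have -> : C = [set: 'S_n].
  apply/eqP; rewrite eqEcard subsetT oC /= -(Lagrange (subsetT G)) iG.
  by rewrite muln1.
have -> : [set s in [set: 'S_n] | derangement s] = [set s | derangement s].
  by apply/setP => s; rewrite !inE.
move/(congr1 (fun k => (k%:R : int)%R)).
rewrite count_derangements twice_even_derangementsE ?(ltnW n_gt1) //.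
move/eqP; rewrite -{1}[X in X == _]addr0 (inj_eq (addrI _)) eq_sym mulf_eq0 signr_eq0 /=.
rewrite subr_eq0 -[1%R]/(1%:R)%R Num.Theory.eqr_nat => /eqP n1.
by rewrite -n1 in n_gt1.
Qed.

End IndexTwo.

(** * Degree 7 *)

(** Composition in one-line notation; the left word acts first, as in [s * t]. *)
Definition word_comp (u v : seq nat) : seq nat := [seq nth 0 v i | i <- u].

(** The fourth power turns an element with one 3-cycle and other cycles of length 1, 2 or 4 into a
    3-cycle. *)
Definition word_fourth (u : seq nat) : seq nat :=
  let v := word_comp u u in word_comp v v.

Definition word_three_cycle (u : seq nat) : bool :=
  (count (fun i => nth 0 u i == i) (iota 0 7) == 4)
    && (word_comp u (word_comp u u) == iota 0 7).

Definition word_derangement (u : seq nat) : bool :=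
  all (fun i => nth 0 u i != i) (iota 0 7).

(* Preservation of the Fano plane with lines [{i, i + d, i + 3}] modulo 7, [d = 1, 2]. *)
Definition word_fano (d : nat) (u : seq nat) : bool :=
  all (fun i => has (fun k => perm_eq [:: nth 0 u i; nth 0 u ((i + d) %% 7); nth 0 u ((i + 3) %% 7)]
                                      [:: k; (k + d) %% 7; (k + 3) %% 7]) (iota 0 7)) (iota 0 7).

Definition word_linear (u : seq nat) : bool :=
  all (fun i => nth 0 u i == (i * nth 0 u 1) %% 7) (iota 0 7).

Definition word_special (u : seq nat) : bool :=
  [|| word_fano 1 u, word_fano 2 u | word_linear u].

Definition words_fix0 : seq (seq nat) := [seq 0 :: v | v <- permutations (iota 1 6)].

(* With [c = (0 1 2 3 4 5 6)], [word_twist (word s) i j] is the word of [c^i s c^j s]. *)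
Definition word_twist (u : seq nat) (i j : nat) : seq nat := word_comp (seq.rot i u) (seq.rot j u).

(** Adding a constant modulo 7 is right multiplication by a power of the 7-cycle; this one makes the
    word fix 0. *)
Definition word_normalize (u : seq nat) : seq nat := [seq (j + (7 - head 0 u)) %% 7 | j <- u].

Definition word_twists (u : seq nat) : seq (seq nat) :=
  [seq word_normalize (word_twist u i j) | i <- iota 0 7, j <- iota 0 7].

Definition words_fano (d : nat) : seq (seq nat) :=
  [seq seq.rot i u | u <- filter (word_fano d) words_fix0, i <- iota 0 7].

(** Without 3-cycles, a group containing the 7-cycle can have only special words in the stabiliser
    of 0. *)
Lemma twist_three_cycle_check :
  all (fun u => word_special u
    || has (fun i => has (fun j => word_three_cycle (word_fourth (word_twist u i j))) (iota 0 7))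
      (iota 0 7))
    words_fix0.
Proof. by vm_compute. Qed.

(** One nonlinear element preserving a Fano plane thus forces the whole stabiliser of 0 to preserve
    that plane. *)
Lemma fano_closed_check (d : nat) : (d == 1) || (d == 2) ->
  allrel (fun u v => ~~ word_special (word_comp u v))
    [seq u <- words_fix0 | word_fano d u && ~~ word_linear u]
    [seq v <- words_fix0 | word_special v && ~~ word_fano d v].
Proof. by case/orP => /eqP->; vm_compute. Qed.

(** With order a multiple of 12 and at most 24, having more than 12 elements leaves only 24 for the
    stabiliser. *)
Lemma fano_generate_check (d : nat) : (d == 1) || (d == 2) ->
  all (fun u => 12 < size (undup (word_twists u)))
    [seq u <- words_fix0 | word_fano d u && ~~ word_linear u].
Proof. by case/orP => /eqP->; vm_compute. Qed.

Lemma fano_size_check (d : nat) : (d == 1) || (d == 2) -> size (filter (word_fano d) words_fix0)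
  = 24.
Proof. by case/orP => /eqP->; vm_compute. Qed.

Lemma linear_size_check : size (filter word_linear words_fix0) = 6.
Proof. by vm_compute. Qed.

Lemma fano_coset_check (d : nat) : (d == 1) || (d == 2) ->
  let L := words_fano d in
  all (fun v => count (fun u => word_derangement (word_comp u v)) L != 62) words_fix0.
Proof. by case/orP => /eqP->; vm_compute. Qed.

(** * Permutations of seven points as words *)

Section Seven.

Local Open Scope group_scope.

Implicit Types (s t g x : 'S_7) (G : {group 'S_7}).

Definition word s : seq nat := [seq val (s i) | i <- enum 'I_7].

Lemma size_word s : size (word s) = 7.
Proof. by rewrite size_map size_enum_ord. Qed.

Lemma nth_word s (i : 'I_7) : nth 0 (word s) i = s i.
Proof. by rewrite (nth_map i) ?size_enum_ord // nth_ord_enum. Qed.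

Lemma word_inj : injective word.
Proof.
by move=> s t st; apply/permP => i; apply: val_inj; rewrite /= -!nth_word st.
Qed.

Lemma wordM s t : word (s * t) = word_comp (word s) (word t).
Proof.
rewrite /word_comp {2}/word -map_comp; apply: eq_map => i /=.
by rewrite permM nth_word.
Qed.

Lemma all_iota7 (P : pred nat) : all P (iota 0 7) = [forall i : 'I_7, P i].
Proof.
rewrite -val_enum_ord all_map; apply/allP/forallP => [h i|h i _]; last exact: h.
by apply: h; rewrite mem_enum.
Qed.

Lemma count_iota7 (P : pred nat) : count P (iota 0 7) = #|[set i : 'I_7 | P i]|.
Proof.
rewrite -val_enum_ord count_map -sum1_count big_enum_cond -sum1_card.
by apply: eq_bigl => i; rewrite !inE.
Qed.

Lemma word1 : word 1 = iota 0 7.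
Proof. by rewrite -val_enum_ord; apply: eq_map => i; rewrite perm1. Qed.

Lemma word_derangementE s : word_derangement (word s) = derangement s.
Proof. by rewrite /word_derangement all_iota7; apply: eq_forallb => i; rewrite nth_word. Qed.

Lemma word_three_cycleP s : word_three_cycle (word s) ->
  exists D : {set 'I_7}, [/\ perm_on D s, #[s] = 3 & #|D| = 3].
Proof.
rewrite /word_three_cycle count_iota7 => /andP[/eqP fix4 /eqP s3].
exists (~: [set i : 'I_7 | nth 0 (word s) i == i]).
have D3 : #|~: [set i : 'I_7 | nth 0 (word s) i == i]| = 3 by rewrite cardsCs setCK fix4 card_ord.
split=> //.
  by apply/subsetP => i; rewrite !inE nth_word.
have s_neq1 : s != 1.
  have : 0 < #|~: [set i : 'I_7 | nth 0 (word s) i == i]| by rewrite D3.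
  case/card_gt0P => i; rewrite !inE nth_word; apply: contraNneq => ->.
  by rewrite perm1.
apply/prime_nt_dvdP; rewrite ?order_eq1 // order_dvdn.
by apply/eqP/word_inj; rewrite word1 -s3 -!wordM.
Qed.

Definition seven_cycle : 'S_7 := perm (@ordS_inj 7).

Lemma word_seven_cycle : word seven_cycle = [seq i.+1 %% 7 | i <- iota 0 7].
Proof.
by rewrite -val_enum_ord -map_comp; apply: eq_map => i /=; rewrite permE.
Qed.

Lemma wordMl s k : k <= 7 -> word (seven_cycle ^+ k * s) = seq.rot k (word s).
Proof.
elim: k => [|k IHk] lek7; first by rewrite expg0 mul1g rot0.
rewrite expgS -mulgA wordM IHk 1?ltnW // rotS ?size_word // word_seven_cycle.
have := size_rot k (word s); rewrite size_word.
by case: (seq.rot k _) => [|? [|? [|? [|? [|? [|? [|? []]]]]]]].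
Qed.

Lemma wordMr s k : k <= 7 -> word (s * seven_cycle ^+ k) = [seq (j + k) %% 7 | j <- word s].
Proof.
move=> lek7; rewrite wordM -[seven_cycle ^+ k]mulg1 wordMl // word1.
apply/eq_in_map => _ /mapP[i _ ->]; move: (s i) => {}i.
have /allP/(_ k) : all (fun k => all (fun j => nth 0 (seq.rot k (iota 0 7)) j == (j + k) %% 7)
  (iota 0 7))
  (iota 0 8) by [].
by rewrite mem_iota => /(_ lek7)/allP/(_ i); rewrite mem_iota ltn_ord => /(_ isT)/eqP.
Qed.

Lemma seven_cycleX (i : 'I_7) k : k <= 7 -> (seven_cycle ^+ k) i = (i + k) %% 7 :> nat.
Proof.
move=> lek7; rewrite -nth_word -[seven_cycle ^+ k]mul1g wordMr // word1.
by rewrite (nth_map 0) ?size_iota // nth_iota.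
Qed.

Lemma seven_cycle_fix0 t : exists2 i, i < 7 & (seven_cycle ^- i * t) ord0 = ord0.
Proof.
have lt7 : (7 - t^-1 ord0) %% 7 < 7 by rewrite ltn_mod.
exists ((7 - t^-1 ord0) %% 7) => //; rewrite permM; apply: (@perm_inj _ t^-1); rewrite permK.
apply: (@perm_inj _ (seven_cycle ^+ ((7 - t^-1 ord0) %% 7))); rewrite permKV.
apply: val_inj; rewrite /= seven_cycleX ?(ltnW lt7) //.
by rewrite modnDmr subnKC ?modnn // ltnW.
Qed.

Lemma mem_words_fix0 s : s ord0 = ord0 -> word s \in words_fix0.
Proof.
move=> s0; have us : uniq (word s).
  by rewrite map_inj_uniq ?enum_uniq // => i j /val_inj/perm_inj.
have sub : {subset word s <= iota 0 7} by move=> _ /mapP[i _ ->]; rewrite mem_iota ltn_ord.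
have [_ eq_s] := uniq_min_size us sub (eq_leq (esym (size_word s))).
have := uniq_perm us (iota_uniq 0 7) eq_s.
have := nth_word s ord0; rewrite s0 /=.
case: (word s) => [|a v] /=; first by move=> _ /perm_size.
move=> ->; rewrite perm_cons => pv; apply: map_f.
by rewrite mem_permutations.
Qed.

(** * Groups containing the 7-cycle but no 3-cycle *)

Section NoThreeCycle.

Variable G : {group 'S_7}.
Hypothesis Gc : seven_cycle \in G.
Hypothesis no3 : forall s, s \in G -> ~~ word_three_cycle (word s).
Hypothesis oG : 84 %| #|G|.

Let G0 : {group 'S_7} := 'C_G[ord0 | 'P]%G.

Let G0P s : reflect (s \in G /\ s ord0 = ord0) (s \in G0).
Proof.
apply: (iffP setIP) => -[Gs s0]; split=> //; first exact: (astab1P s0).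
by apply/astab1P.
Qed.

Let cG k : seven_cycle ^+ k \in G. Proof. exact: groupX. Qed.

Let twist_in u i j : i <= 7 -> j <= 7 -> u \in G ->
  exists2 t, t \in G & word t = word_twist (word u) i j.
Proof.
move=> lei lej Gu; exists (seven_cycle ^+ i * u * (seven_cycle ^+ j * u)).
  by rewrite !groupM ?cG.
by rewrite wordM !wordMl.
Qed.

Let normalize_in t : t \in G -> exists2 s, s \in G0 & word s = word_normalize (word t).
Proof.
move=> Gt; have hd : head 0 (word t) = t ord0 by rewrite -nth0 (nth_word t ord0).
have le_t : 7 - t ord0 <= 7 by apply: leq_subr.
exists (t * seven_cycle ^+ (7 - t ord0)); last by rewrite wordMr // /word_normalize hd.
apply/G0P; split; first by rewrite groupM ?cG.
apply: val_inj; rewrite /= -nth_word wordMr // (nth_map 0) ?size_word // (nth_word t ord0).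
by rewrite subnKC ?modnn // ltnW.
Qed.

Let card_G : (#|G| = 7 * #|G0|)%N.
Proof.
rewrite -(card_orbit_stab 'P G ord0); congr (_ * _)%N.
have -> : orbit 'P G ord0 = setT; last by rewrite cardsT card_ord.
apply/setP => i; rewrite !inE; apply/orbitP; exists (seven_cycle ^+ i); first exact: cG.
by apply: val_inj; rewrite /= /aperm seven_cycleX ?add0n ?modn_small // ltnW.
Qed.

Let card_G0_dvd : 12 %| #|G0|.
Proof. by move: oG; rewrite card_G (_ : 84 = 7 * 12)%N // dvdn_pmul2l. Qed.

Let G0_special s : s \in G0 -> word_special (word s).
Proof.
move=> /G0P[Gs s0]; have /allP/(_ _ (mem_words_fix0 s0)) := twist_three_cycle_check.
case/orP => // /hasP[i]; rewrite mem_iota => i7 /hasP[j]; rewrite mem_iota => j7.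
have [t Gt <-] := twist_in (ltnW i7) (ltnW j7) Gs.
have := no3 (groupX 4 Gt); rewrite !expgS expg0 mulg1 mulgA !wordM => /negP h /h.
by [].
Qed.

Let card_G0_leq (P : pred (seq nat)) :
  (forall s, s \in G0 -> P (word s)) -> #|G0| <= size (filter P words_fix0).
Proof.
move=> G0P'; rewrite cardE -(size_map word); apply: uniq_leq_size.
  by rewrite map_inj_uniq ?enum_uniq //; apply: word_inj.
move=> _ /mapP[s + ->]; rewrite mem_enum => Gs; rewrite mem_filter G0P' //.
by apply: mem_words_fix0; case: (G0P _ Gs).
Qed.

(** There are only six linear words, fewer than the 12 that must divide the order of the stabiliser
    of 0. *)
Let exists_fano : exists (d : nat) s, [/\ (d == 1%N) || (d == 2), s \in G0, word_fano d (word s)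
  & ~~ word_linear (word s)].
Proof.
have /existsP[s /andP[Gs ns]] : [exists s, (s \in G0) && ~~ word_linear (word s)].
  apply: contraT; rewrite negb_exists => /forallP lin.
  have := dvdn_leq (cardG_gt0 _) card_G0_dvd; rewrite leqNgt => /negP[].
  have le6 : #|G0| <= size (filter word_linear words_fix0).
    by apply: card_G0_leq => s Gs; have := lin s; rewrite Gs negbK.
  by rewrite linear_size_check in le6; apply: leq_ltn_trans le6 _.
have := G0_special Gs; rewrite /word_special (negPf ns) orbF => /orP[] fs.
  by exists 1%N, s; split.
by exists 2, s; split.
Qed.

Let words_of_G : #|G| = 168 /\ exists2 d, (d == 1%N) || (d == 2) &
  perm_eq [seq word s | s <- enum G] (words_fano d).
Proof.
have [d [s [d12 Gs fs ns]]] := exists_fano.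
have mem_s : word s \in [seq u <- words_fix0 | word_fano d u && ~~ word_linear u].
  by rewrite mem_filter fs ns mem_words_fix0 //; case: (G0P _ Gs).
have G0_fano t : t \in G0 -> word_fano d (word t).
  move=> Gt; apply: contraT => nt.
  have /allrelP/(_ (word s) (word t)) := fano_closed_check d12; rewrite mem_s mem_filter nt.
  rewrite G0_special // mem_words_fix0; last by case: (G0P _ Gt).
  by move=> /(_ isT isT); rewrite -wordM G0_special ?groupM.
have G0_le24 := card_G0_leq G0_fano; rewrite (fano_size_check d12) in G0_le24.
have G0_gt12 : 12 < #|G0|.
  have /allP/(_ _ mem_s)/leq_trans := fano_generate_check d12; apply.
  rewrite cardE -(size_map word); apply: uniq_leq_size; first exact: undup_uniq.
  move=> u; rewrite mem_undup => /allpairsP[[i j] [+ + ->]].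
  rewrite (mem_iota 0 7 i) (mem_iota 0 7 j) => i7 j7; have [Gs' _] := G0P _ Gs.
  have [t Gt <-] := twist_in (ltnW i7) (ltnW j7) Gs'.
  by have [t' Gt' <-] := normalize_in Gt; apply: map_f; rewrite mem_enum.
have G0_24 : #|G0| = 24.
  by case/dvdnP: card_G0_dvd G0_le24 G0_gt12 => k ->; clear; lia.
split; first by rewrite card_G G0_24.
exists d => //.
have uG : uniq [seq word s | s <- enum G] by rewrite map_inj_uniq ?enum_uniq //; apply: word_inj.
have sz : size (words_fano d) <= size [seq word s | s <- enum G].
  by rewrite size_map -cardE card_G G0_24 size_allpairs fano_size_check ?size_iota.
have sub : {subset [seq word s | s <- enum G] <= words_fano d}.
  move=> _ /mapP[t + ->]; rewrite mem_enum => Gt.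
  have [i i7 fix0] := seven_cycle_fix0 t.
  have Gs0 : seven_cycle ^- i * t \in G0 by apply/G0P; split=> //; rewrite groupM ?groupV ?cG.
  rewrite -[t](mulKVg (seven_cycle ^+ i)) wordMl ?(ltnW i7) //; apply: allpairs_f.
    by rewrite mem_filter G0_fano // mem_words_fix0.
  by rewrite mem_iota.
have [sz_eq mem_eq] := uniq_min_size uG sub sz.
by apply: uniq_perm => //; rewrite (uniq_size_uniq uG mem_eq) sz_eq.
Qed.

Lemma card_without_three_cycle : #|G| = 168.
Proof. by case: words_of_G. Qed.

Lemma coset_derangements_neq62 x : #|[set s in G :* x | derangement s]| != 62.
Proof.
(* As [G] contains the 7-cycle, the coset has a representative fixing 0, so the check over
   [words_fix0] covers all cosets. *)
have [i i7 fix0] := seven_cycle_fix0 x.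
set y := seven_cycle ^- i * x in fix0.
have -> : G :* x = G :* y by rewrite /y rcosetM (rcoset_id (groupVr (cG i))).
have -> : [set s in G :* y | derangement s] = [set g * y | g in G & derangement (g * y)].
  apply/setP => s; rewrite inE; apply/andP/imsetP.
    by move=> [/rcosetP[g Gg ->] ds]; exists g; rewrite ?inE ?Gg.
  by move=> [g]; rewrite inE => /andP[Gg dg] ->; rewrite mem_rcoset mulgK.
rewrite card_imset; last exact: mulIg.
have [_ [d d12 /seq.permP/(_ (fun u => word_derangement (word_comp u (word y)))) eqc]] :=
  words_of_G.
have /allP/(_ (word y) (mem_words_fix0 fix0)) := fano_coset_check d12.
rewrite -eqc count_map -sum1_count big_enum_cond -sum1_card.
by congr (_ != _); apply: eq_bigl => g; rewrite /= -wordM word_derangementE !inE.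
Qed.

End NoThreeCycle.

End Seven.

(** * The index divides 2 *)

Section Conclusion.

Local Open Scope group_scope.

Lemma twice_even_derangements7 : twice_even_derangements 7 = 1860.
Proof.
have := twice_even_derangementsE 7 isT.
rewrite !big_ord_recl big_ord0 /= /bump /= !ssralg.GRing.exprS !ssralg.GRing.expr0 !ffactnS
  !ffactn0 /=.
rewrite !natz; lia.
Qed.

Lemma primitive_of_index_dvd_derangements (n : nat) (G : {group 'S_n}) : 7 <= n ->
  #|[set: 'S_n] : G| %| twice_even_derangements n -> [primitive G, on setT | 'P].
Proof.
move=> n_ge7 KE; have n_gt0 : 0 < n by apply: leq_trans n_ge7.
apply: (primitive_of_index_dvd n G (twice_even_derangements n)) => // q.
- exact: dvd_twice_even_derangements0.
- by apply: dvd_twice_even_derangements3; apply: leq_trans n_ge7.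
- by apply: dvd_twice_even_derangements4; apply: leq_trans n_ge7.
Qed.

Lemma index_conj (gT : finGroupType) (G : {group gT}) (x : gT) :
  #|[set: gT] : G :^ x| = #|[set: gT] : G|.
Proof. by rewrite -!divgS ?subsetT // cardJg. Qed.

Lemma lcoset_rcoset_conj (gT : finGroupType) (G : {group gT}) (x : gT) :
  x *: G = G :^ x^-1 :* x.
Proof.
by apply/setP => s; rewrite mem_lcoset mem_rcoset mem_conjg invgK conjgE mulgKV.
Qed.

Lemma derangementJ (n : nat) (s t : 'S_n) : derangement (s ^ t) = derangement s.
Proof.
apply/forallP/forallP => h i.
  by have := h (t i); rewrite permJ (inj_eq perm_inj).
by rewrite -[i](permKV t) permJ (inj_eq perm_inj).
Qed.

(** A 3-cycle would settle the matter by Jordan's theorem. Without one, the index divides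
    [gcd(1860, 5040) = 60], so 84 divides the order; the order is then 168, the index 30, and the
    coset has 62 derangements, which is excluded. *)
Lemma index_dvd2_of_seven_cycle (G : {group 'S_7}) (x : 'S_7) : seven_cycle \in G ->
    (#|[set s in G :* x | derangement s]| * #|[set: 'S_7] : G| = 1860)%N ->
  #|[set: 'S_7] : G| %| 2.
Proof.
move=> Gc eqK; set K := #|_ : _| in eqK *.
have K_dvd : K %| 1860 by rewrite -eqK dvdn_mull.
have primG : [primitive G, on setT | 'P].
  by apply: primitive_of_index_dvd_derangements; rewrite // twice_even_derangements7.
apply: contraT => K2.
have no3 s : s \in G -> ~~ word_three_cycle (word s).
  move=> Gs; apply: contra K2 => /word_three_cycleP[D [on_s os D3]].
  apply: (index_dvd2_of_transitive3 primG D3).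
  exact: (fix_outside_transitive (isT : prime 3) Gs on_s os D3).
have oGK : (#|G| * K = 5040)%N by rewrite Lagrange ?subsetT // cardsT card_Sn.
have K60 : K %| 60 by rewrite -[60]/(gcdn 1860 5040) dvdn_gcd K_dvd -oGK dvdn_mull.
have oG : 84 %| #|G|.
  case/dvdnP: K60 => m mK; apply/dvdnP; exists m.
  have K_gt0 : 0 < K by apply: indexg_gt0.
  apply/eqP; rewrite -(eqn_pmul2r K_gt0) oGK mulnAC -mK.
  by [].
have := coset_derangements_neq62 Gc no3 oG x.
move: oGK; rewrite (card_without_three_cycle Gc no3 oG) => K30.
have {}K30 : K = 30 by apply/eqP; rewrite -(@eqn_pmul2l 168) // K30.
by rewrite -(@eqn_pmul2r 30) // -{1}K30 eqK.
Qed.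

(** Since 7 does not divide 1860, [G] contains some 7-cycle; relabelling the points makes it
    [seven_cycle] and keeps index and derangement count. *)
Lemma index_dvd2_seven (G : {group 'S_7}) (x : 'S_7) :
    (#|[set s in G :* x | derangement s]| * #|[set: 'S_7] : G| = 1860)%N ->
  #|[set: 'S_7] : G| %| 2.
Proof.
move=> eqK; have K7 : ~~ (7 %| #|[set: 'S_7] : G|).
  by apply/negP => /(dvdn_mull #|[set s in G :* x | derangement s]|); rewrite eqK.
have [|D [c [Gc on_c oc D7]]] := exists_prime_cycle (isT : prime 7) _ K7; first by rewrite card_ord.
have DT : D = setT by apply/eqP; rewrite eqEcard subsetT cardsT card_ord D7.
have trc := cycle_transitive (isT : prime 7) on_c oc D7.
rewrite DT in trc.
have modc k : c ^+ (k %% 7) = c ^+ k by have := expg_mod_order c k; rewrite oc.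
pose f (i : 'I_7) := (c ^+ i) ord0.
have f_inj : injective f.
  suff /imset_injP f_inj : #|f @: setT| == #|[set: 'I_7]| by move=> i j; apply: f_inj; rewrite inE.
  have -> : f @: setT = setT; last by [].
  apply/setP => y; rewrite inE; apply/imsetP.
  have [_ /cycleP[k ->] yE] := atransP2 trc (in_setT ord0) (in_setT y).
  exists (Ordinal (ltn_pmod k (isT : 0 < 7))); rewrite ?inE // /f /= yE /= /aperm.
  by rewrite modc.
pose h := perm f_inj.
have cE : seven_cycle = c ^ h^-1.
  rewrite conjgE invgK; apply: (mulIg h); rewrite -mulgA mulgKV.
  apply/permP => i; rewrite !permM !permE /f /= -permM -expgSr.
  by rewrite modc.
rewrite -(index_conj G h^-1); apply: (@index_dvd2_of_seven_cycle (G :^ h^-1)%G (x ^ h^-1)).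
  by rewrite cE memJ_conjg.
rewrite index_conj -eqK -conjg_set1 -conjsMg; congr (_ * _)%N.
rewrite -[RHS](cardJg _ h^-1); congr #|pred_of_set _|; apply/setP => s.
by rewrite !inE !mem_conjg !inE derangementJ.
Qed.

Lemma index_dvd2_large (n : nat) (G : {group 'S_n}) : 8 <= n ->
  #|[set: 'S_n] : G| %| twice_even_derangements n -> #|[set: 'S_n] : G| %| 2.
Proof.
move=> n_ge8 KE; have primG := primitive_of_index_dvd_derangements (ltnW n_ge8) KE.
have [||p [p_pr p_gt2 p_le pE]] := exists_odd_prime_ndvd n (twice_even_derangements n) n_ge8.
- by move=> q; apply: dvd_twice_even_derangements3; apply: leq_trans n_ge8.
- by move=> q; apply: dvd_twice_even_derangements4; apply: leq_trans n_ge8.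
have pK : ~~ (p %| #|[set: 'S_n] : G|) by apply: contra pE => /dvdn_trans; apply.
have le_pn : p + 3 <= #|'I_n| by rewrite card_ord -(@subnK 3 n) ?leq_add2r // (leq_trans _ n_ge8).
have [|D [c [Gc on_c oc Dp]]] := exists_prime_cycle p_pr _ pK.
  exact: leq_trans (leq_addr _ _) le_pn.
(* A 3-cycle is already enough; for [p > 3] the bound [p <= n - 3] leaves the three extra points the
   commutator argument uses. *)
have [p3|p_neq3] := eqVneq p 3.
  apply: (index_dvd2_of_transitive3 primG (etrans Dp p3)).
  exact: fix_outside_transitive p_pr Gc on_c oc Dp.
apply: (index_dvd2_of_prime_cycle p_pr Gc on_c oc Dp primG _ le_pn).
by rewrite ltn_neqAle eq_sym p_neq3.
Qed.

Lemma index_dvd2 (n : nat) (G : {group 'S_n}) (x : 'S_n) : 7 <= n ->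
    (#|[set s in G :* x | derangement s]| * #|[set: 'S_n] : G| = twice_even_derangements n)%N ->
  #|[set: 'S_n] : G| %| 2.
Proof.
rewrite leq_eqVlt => /orP[/eqP n7|n_ge8 eqK]; last by apply: index_dvd2_large;
  rewrite // -eqK dvdn_mull.
by case: n / n7 G x => G x; rewrite twice_even_derangements7; apply: index_dvd2_seven.
Qed.

End Conclusion.

Unset Implicit Arguments.
Set Strict Implicit.

Theorem theorem5p1 (n : nat) (hn : 7 <= n) (G : {group 'S_n}) (C : {set 'S_n})
    (hC : C \in lcosets G [set: 'S_n] \/ C \in rcosets G [set: 'S_n])
    (hratio : derangement_ratio C = derangement_ratio ('Alt_('I_n))%g) :
  G :=: ('Alt_('I_n))%g.
Proof.
have n_gt1 : 1 < n by apply: leq_trans hn.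
have oC := card_coset _ _ _ hC.
have eqK := derangements_mul_index _ _ _ n_gt1 oC hratio.
have K1 := index_neq1 n_gt1 oC hratio.
have K2 : #|[set: 'S_n] : G|%g %| 2.
  (* A left coset of [G] is a right coset of a conjugate of [G], which has the same index. *)
  case: hC => [/lcosetsP|/rcosetsP] [x _ CE]; last by apply: (index_dvd2 (x := x)); rewrite // -CE.
  rewrite -(index_conj G x^-1%g); apply: (@index_dvd2 n (G :^ x^-1)%G x) => //.
  by rewrite index_conj -eqK CE lcoset_rcoset_conj.
apply: Alt_of_index2; first by rewrite card_ord (leq_trans _ hn).
have := dvdn_leq (isT : 0 < 2) K2; rewrite leq_eqVlt ltnS leq_eqVlt (negPf K1) /=.
by rewrite ltnNge indexg_gt0 orbF => /eqP.
Qed.
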